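(* Let $n \ge 1$ and let $\mathfrak{s}$ be a subset of $\mathfrak{u}(T_n)$. Then $\mathfrak{s}$ is an independent set of the tiling matroid $\mathcal{T}_n$ if and only if the lattice region $T_n \setminus A(\mathfrak{s})$ admits a tiling whose tiles are unit rhombi and exactly $n - |\mathfrak{s}|$ type-1 trapezoids.
   Context: $T_n$ is a closed equilateral triangle of side length $n$ with a horizontal base and apex pointing up, subdivided by the lines parallel to its sides at integer distances into $n^2$ closed unit equilateral triangles: the $n(n+1)/2$ upward-pointing ones are the unit upward triangles, forming the set $\mathfrak{u}(T_n)$, and the $n(n-1)/2$ downward-pointing ones are the unit downward triangles. A lattice upward triangle of size $k$ is an upward equilateral triangle of side $k$ contained in $T_n$ that is a union of unit triangles (a translate of $T_k$ inside $T_n$); for such $T$, $\mathfrak{u}(T)$ denotes the set of unit upward triangles contained in $T$. The tiling matroid $\mathcal{T}_n$ is the matroid with ground set $\mathfrak{u}(T_n)$ whose independent sets are the subsets $\mathfrak{s}$ such that $|\mathfrak{s} \cap \mathfrak{u}(T)| \le k$ for every lattice upward triangle $T$ of size $k$, $1\le k\le n$. A lattice region is a nonempty subset of $T_n$ whose closure is a union of unit triangles. For $\mathfrak{s} \subseteq \mathfrak{u}(T_n)$, $A(\mathfrak{s})$ is the union of the triangles in $\mathfrak{s}$. A tiling of a lattice region $R$ is a collection of closed lattice regions with pairwise disjoint interiors whose union is the closure of $R$. A unit rhombus is the union of two unit triangles sharing an edge. A type-1 trapezoid is a lattice trapezoid that is the union of two unit upward triangles and one unit downward triangle.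
   Formalization: The cases n = 1 and n = 2 with s empty are excluded: there s is independent, but T_1 and T_2 have fewer than n unit downward triangles, so no tiling with n type-1 trapezoids exists and the stated equivalence fails. *)

(* Defs.v *)
From HB Require Import structures.
From mathcomp Require Import all_boot all_order all_algebra.
From mathcomp Require Import all_classical all_reals all_analysis.
Import Order.TTheory GRing.Theory Num.Theory.
Import numFieldNormedType.Exports.

Set Implicit Arguments.
Unset Strict Implicit.
Unset Printing Implicit Defensive.

Local Open Scope classical_set_scope.
Local Open Scope ring_scope.

Section Plane.
Variable R : realType.

(* [R^o] rather than [R] so that the plane is a left [R]-module as well as a
   topological space. *)
Definition plane : Type := (R^o * R^o)%type.

Definition hull (vs : seq plane) : set plane :=
  [set x | exists w : 'I_(size vs) -> R,
    [/\ forall i, 0 <= w i, \sum_i w i = 1 & x = \sum_i w i *: vs`_i]].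

(* The lattice point [i e1 + j e2] with [e1 = (1, 0)], [e2 = (1/2, sqrt 3 / 2)]. *)
Definition lpoint (p : nat * nat) : plane :=
  (p.1%:R + p.2%:R / 2, p.2%:R * (Num.sqrt 3 / 2)).

(* Upward triangle of side [k] with lower left corner [i e1 + j e2]. *)
Definition utriangle (k i j : nat) : set plane :=
  hull [seq lpoint p | p <- [:: (i, j); (i + k, j); (i, j + k)]%N].

Definition bigT (n : nat) : set plane := utriangle n 0 0.

(* A convex quadrilateral a, b, d + t (b - a), d with a pair of parallel sides;
   the second condition says that a, b, d are not collinear. *)
Definition trapezoid (P : set plane) : Prop :=
  exists (a b d : plane) (t : R),
    [/\ 0 < t,
        (b.1 - a.1) * (d.2 - a.2) != (b.2 - a.2) * (d.1 - a.1)
      & P = hull [:: a; b; d + t *: (b - a); d]].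

End Plane.

Arguments utriangle : clear implicits.
Arguments bigT : clear implicits.

(* Unit upward triangles of [bigT n], indexed by their lower left corner, and
   unit downward triangles: (i, j) stands for the one sharing its lower left
   edge with the upward triangle (i, j). *)
Definition up_triangle (n : nat) : finType := {p : 'I_n * 'I_n | (p.1 + p.2 < n)%N}.
Definition down_triangle (n : nat) : finType := {p : 'I_n * 'I_n | (p.1 + p.2 + 1 < n)%N}.
Definition unit_triangle (n : nat) : finType := (up_triangle n + down_triangle n)%type.

Definition vertices (n : nat) (t : unit_triangle n) : seq (nat * nat) :=
  match t with
  | inl u => let: (i, j) := (val (val u).1, val (val u).2) in
             [:: (i, j); (i.+1, j); (i, j.+1)]
  | inr d => let: (i, j) := (val (val d).1, val (val d).2) in
             [:: (i.+1, j); (i, j.+1); (i.+1, j.+1)]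
  end.

Definition share_edge (n : nat) (t t' : unit_triangle n) : Prop :=
  t != t' /\ exists p q : nat * nat,
    [/\ p != q, p \in vertices t, q \in vertices t,
        p \in vertices t' & q \in vertices t'].

Section Regions.
Variables (R : realType) (n : nat).
Notation plane := (plane R).

Definition cell (t : unit_triangle n) : set plane :=
  hull [seq lpoint R p | p <- vertices t].

Definition up_cell (u : up_triangle n) : set plane := cell (inl u).
Definition down_cell (d : down_triangle n) : set plane := cell (inr d).

Definition lattice_up_triangle (k : nat) (T : set plane) : Prop :=
  exists i j : nat, (i + j + k <= n)%N /\ T = utriangle R k i j.

Definition ups_in (T : set plane) : {set up_triangle n} :=
  [set u : up_triangle n | `[< up_cell u `<=` T >]]%SET.

Definition tm_independent (s : {set up_triangle n}) : Prop :=
  forall (k : nat) (T : set plane),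
    (1 <= k <= n)%N -> lattice_up_triangle k T -> (#|s :&: ups_in T|%SET <= k)%N.

Definition lattice_region (P : set plane) : Prop :=
  [/\ P !=set0, P `<=` bigT R n
    & exists c : {set unit_triangle n}, closure P = \bigcup_(t in [set` c]) cell t].

Definition A_ (s : {set up_triangle n}) : set plane := \bigcup_(u in [set` s]) up_cell u.

Definition tiling (P : set plane) (C : set (set plane)) : Prop :=
  [/\ forall Q, C Q -> closed Q /\ lattice_region Q,
      forall Q Q', C Q -> C Q' -> Q <> Q' -> interior Q `&` interior Q' = set0
    & \bigcup_(Q in C) Q = closure P].

Definition unit_rhombus (P : set plane) : Prop :=
  exists t t' : unit_triangle n, share_edge t t' /\ P = cell t `|` cell t'.

Definition type1_trapezoid (P : set plane) : Prop :=
  trapezoid P /\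
  exists (u u' : up_triangle n) (d : down_triangle n),
    u != u' /\ P = up_cell u `|` up_cell u' `|` down_cell d.

End Regions.

Arguments tm_independent R {n} s.
Arguments A_ R {n} s _.

(* Main.v *)
(* Each tile contains exactly one downward triangle, and it contains one (rhombus)
   or two (trapezoid) upward triangles adjacent to it.  A tiling is therefore an
   assignment of the upward triangles outside [s] to adjacent downward triangles
   in which every downward triangle receives one or two of them.

   Given such a tiling, the k(k-1)/2 downward triangles of a triangle of size k
   receive distinct upward triangles of it outside [s], so at most k of its
   k(k+1)/2 upward triangles are in [s].

   Conversely, let [s] be independent.  Hall's theorem, applied to two copies of
   every downward triangle and |D| - (n - |s|) dummies which may only use the
   second copies, reduces the existence of an assignment to two inequalities.
   The first, |Y| <= 2 |N(Y)|, follows from an explicit two-to-one map.  The second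
   is |X| + |N(X) /\ s| <= |N(X)| for sets X of downward triangles.  Adding to X a
   downward triangle with two neighbours in N(X) only makes it harder, so X may be
   assumed closed under this operation; a maximal lattice triangle whose downward
   triangles lie in X then shares no neighbour with the rest of X and can be split
   off, using independence inside it. *)

Require Import Defs.
From mathcomp Require Import all_boot all_order all_algebra.
From mathcomp Require Import all_classical all_reals all_analysis.
From mathcomp Require Import zify ring lra.

Set Implicit Arguments.
Unset Strict Implicit.
Unset Printing Implicit Defensive.
Import Order.TTheory GRing.Theory Num.Theory.
Import numFieldNormedType.Exports.

(** * Hall's theorem *)

Definition hall (L R : finType) (e : L -> {set R}) : Prop :=
  forall Y : {set L}, #|Y| <= #|\bigcup_(x in Y) e x|.

Definition shrink (L R : finType) (e : L -> {set R}) (x : L) (y : R) (z : L) :=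
  if z == x then e z :\ y else e z.

(** A set violating Hall's condition after the deletion must contain [x], since no other [e z] has
    changed. [B] is that set without [x], which turns the strict inequality into a weak one. *)
Lemma shrink_failure (L R : finType) (e : L -> {set R}) (x : L) (y : R) :
  hall e -> ~ hall (shrink e x y) ->
  exists2 B : {set L}, x \notin B &
    #|(e x :\ y) :|: \bigcup_(z in B) e z| <= #|B|.
Proof.
move=> he hs.
have /forallPn /= [Y] : ~~ [forall Y : {set L}, #|Y| <= #|\bigcup_(z in Y) shrink e x y z|].
  by apply/negP => /forallP /= H; apply: hs => Y; apply: H.
rewrite -ltnNge => hY.
have eB (B : {set L}) : x \notin B ->
    \bigcup_(z in B) shrink e x y z = \bigcup_(z in B) e z.
  move=> xB; apply: eq_bigr => z zB; rewrite /shrink; case: eqP => // zx.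
  by rewrite -zx zB in xB.
have xY : x \in Y.
  by apply: contraLR hY => xY; rewrite eB // -leqNgt; apply: he.
exists (Y :\ x); first by rewrite !inE eqxx.
move: hY; rewrite (big_setD1 x xY) /= eB; last by rewrite !inE eqxx.
by rewrite /shrink eqxx (cardsD1 x Y) xY add1n ltnS.
Qed.

(* Rado's argument: a set [e x] with two elements can lose one of them without
   breaking Hall's condition, since two witnesses of failure would contradict
   submodularity of [Y |-> #|\bigcup_(x in Y) e x|]. *)
Lemma hall_marriage (L R : finType) (e : L -> {set R}) :
  hall e -> exists2 g : L -> R, injective g & forall x, g x \in e x.
Proof.
have [N] := ubnP (\sum_x #|e x|); elim: N => // N IH in e * => /ltnSE leN he.
have [[x [y1 [y2 [ny y1e y2e]]]] | sub1] :=
  EM (exists x y1 y2, [/\ y1 != y2, y1 \in e x & y2 \in e x]).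
  have dec y : y \in e x -> \sum_z #|shrink e x y z| < N.
    move=> ye; apply: leq_trans leN.
    rewrite (bigD1 x) //= [X in _ < X](bigD1 x) //= -addSn /shrink eqxx.
    rewrite (cardsD1 y (e x)) ye add1n leq_add2l.
    by apply: leq_sum => z /negPf ->.
  have sub y z : shrink e x y z \subset e z.
    by rewrite /shrink; case: eqP => // _; rewrite subD1set.
  have conc y : y \in e x -> hall (shrink e x y) ->
      exists2 g : L -> R, injective g & forall x, g x \in e x.
    move=> ye hs; have [g gi gP] := IH _ (dec y ye) hs.
    by exists g => // z; apply: (fintype.subsetP (sub y z)).
  have [h1|h1] := EM (hall (shrink e x y1)); first exact: conc h1.
  have [h2|h2] := EM (hall (shrink e x y2)); first exact: conc h2.
  have [B1 xB1 le1] := shrink_failure he h1.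
  have [B2 xB2 le2] := shrink_failure he h2.
  set V1 := _ :|: _ in le1; set V2 := _ :|: _ in le2.
  have hU := he (x |: (B1 :|: B2)); have hI := he (B1 :&: B2).
  (* [e x] is covered because [y1] and [y2] differ: the element deleted in one of [V1], [V2]
     survives in the other. *)
  have sU : \bigcup_(z in x |: (B1 :|: B2)) e z \subset V1 :|: V2.
    apply/finset.bigcupsP => z; rewrite !inE => /or3P[/eqP ->|zB|zB];
      apply/fintype.subsetP => t te; rewrite !inE.
    - by rewrite te !andbT; case: eqP => //= ->; rewrite ny orbT.
    - by apply/orP; left; apply/orP; right; apply/finset.bigcupP; exists z.
    - by apply/orP; right; apply/orP; right; apply/finset.bigcupP; exists z.
  have sI : \bigcup_(z in B1 :&: B2) e z \subset V1 :&: V2.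
    apply/finset.bigcupsP => z; rewrite inE => /andP[z1 z2];
      apply/fintype.subsetP => t te; rewrite !inE.
    by apply/andP; split; apply/orP; right; apply/finset.bigcupP; exists z.
  (* Hall's condition now gives [#|V1| + #|V2| >= #|B1| + #|B2| + 1], against [le1] and [le2]. *)
  have := subset_leq_card sU; have := subset_leq_card sI.
  have := cardsUI V1 V2; have := cardsUI B1 B2.
  have : #|x |: (B1 :|: B2)| = #|B1 :|: B2|.+1.
    by rewrite cardsU1 inE negb_or xB1 xB2.
  lia.
(* Every [e x] now has at most one element, and Hall's condition makes it nonempty. Two equal
   choices would confine the union of two sets to a singleton. *)
have e1 x : exists y, y \in e x.
  apply/set0Pn; rewrite -card_gt0.
  by have := he [set x]; rewrite cards1 big_set1.
exists (fun x => xchoose (e1 x)); last by move=> x; apply: xchooseP.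
move=> x x' exx'; apply/eqP/negPn/negP => nx.
have := he [set x; x']; rewrite cards2 nx big_setU1 ?inE //= big_set1.
suff /subset_leq_card : e x :|: e x' \subset [set xchoose (e1 x)].
  by rewrite cards1; lia.
apply/fintype.subsetP => y; rewrite !inE => H; apply/negPn/negP => ny.
case/orP: H => yH; apply: sub1.
  by exists x, y, (xchoose (e1 x)); rewrite ny yH; split=> //; apply: xchooseP.
rewrite exx' in ny.
by exists x', y, (xchoose (e1 x')); rewrite ny yH; split=> //; apply: xchooseP.
Qed.

(** * Coordinates and counting of unit triangles *)

Definition ui (n : nat) (u : up_triangle n) : nat := val (val u).1.
Definition uj (n : nat) (u : up_triangle n) : nat := val (val u).2.
Definition di (n : nat) (d : down_triangle n) : nat := val (val d).1.
Definition dj (n : nat) (d : down_triangle n) : nat := val (val d).2.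

Lemma uij_lt (n : nat) (u : up_triangle n) : ui u + uj u < n.
Proof. exact: (valP u). Qed.

Lemma dij_lt (n : nat) (d : down_triangle n) : di d + dj d + 1 < n.
Proof. exact: (valP d). Qed.

Lemma uij_inj (n : nat) (u v : up_triangle n) : ui u = ui v -> uj u = uj v -> u = v.
Proof.
move=> hi hj; apply: val_inj; case: u v hi hj => [[i j] h] [[i' j'] h'] /= hi hj.
by congr pair; apply: val_inj.
Qed.

Lemma dij_inj (n : nat) (d e : down_triangle n) : di d = di e -> dj d = dj e -> d = e.
Proof.
move=> hi hj; apply: val_inj; case: d e hi hj => [[i j] h] [[i' j'] h'] /= hi hj.
by congr pair; apply: val_inj.
Qed.

Lemma up_at (n i j : nat) : i + j < n -> {u : up_triangle n | ui u = i & uj u = j}.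
Proof.
move=> h; have hi : i < n by lia. have hj : j < n by lia.
by exists (Sub (Ordinal hi, Ordinal hj) h : up_triangle n).
Qed.

Lemma down_at (n i j : nat) : i + j + 1 < n -> {d : down_triangle n | di d = i & dj d = j}.
Proof.
move=> h; have hi : i < n by lia. have hj : j < n by lia.
by exists (Sub (Ordinal hi, Ordinal hj) h : down_triangle n).
Qed.

Section Combinatorics.
Variable n : nat.
Implicit Types (u v : up_triangle n) (d e : down_triangle n).
Implicit Types (s Y : {set up_triangle n}) (X : {set down_triangle n}).

(** The three cases are the upward triangles across the lower left, lower right and top edge of
    [d]. *)
Definition adj d u : bool :=
  [|| (ui u == di d) && (uj u == dj d), (ui u == (di d).+1) && (uj u == dj d)
    | (ui u == di d) && (uj u == (dj d).+1)].

(** The lattice triangle of side [k] with lower left corner [(a, b)], see [ups_in_utriangle]. In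
    [downsT] the bound on the sum is one tighter because the far vertex of [d] has coordinate sum
    [di d + dj d + 2]. *)
Definition upsT (a b k : nat) : {set up_triangle n} :=
  [set u | [&& a <= ui u, b <= uj u & ui u + uj u < a + b + k]].

Definition downsT (a b k : nat) : {set down_triangle n} :=
  [set d | [&& a <= di d, b <= dj d & di d + dj d + 1 < a + b + k]].

Definition independent s : Prop :=
  forall k a b, 0 < k -> a + b + k <= n -> #|s :&: upsT a b k| <= k.

Lemma dij_ltW d : di d + dj d < n.
Proof. by move: (dij_lt d); lia. Qed.

Definition up_of d : up_triangle n := s2val (up_at (dij_ltW d)).

Lemma up_of_i d : ui (up_of d) = di d.
Proof. by rewrite /up_of; case: up_at. Qed.

Lemma up_of_j d : uj (up_of d) = dj d.
Proof. by rewrite /up_of; case: up_at. Qed.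

Lemma up_of_inj : injective up_of.
Proof.
by move=> d e de; apply: dij_inj; rewrite -?up_of_i -?up_of_j de.
Qed.

(** [up_of] matches the downward triangles with the upward ones off the hypotenuse; the row [D]
    along the hypotenuse has the other [k]. *)
Lemma card_upsT (a b k : nat) : a + b + k <= n -> #|upsT a b k| = #|downsT a b k| + k.
Proof.
move=> hn; pose D := [set u in upsT a b k | ui u + uj u + 1 == a + b + k].
have eU : upsT a b k = (up_of @: downsT a b k) :|: D.
  apply/setP => u; rewrite !inE; apply/idP/idP.
    move=> /and3P[h1 h2 h3].
    case: (ltnP (ui u + uj u + 1) (a + b + k)) => h4; last first.
      by rewrite h1 h2 h3 /=; apply/orP; right; apply/eqP; lia.
    apply/orP; left; apply/imsetP.
    have [|d hi hj] := @down_at n (ui u) (uj u); first by lia.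
    exists d; first by rewrite inE hi hj h1 h2.
    by apply: uij_inj; rewrite ?up_of_i ?up_of_j.
  case/orP; last by case/andP.
  case/imsetP => d; rewrite inE => /and3P[h1 h2 h3] ->.
  by rewrite up_of_i up_of_j h1 h2 /=; lia.
have dis : [disjoint up_of @: downsT a b k & D].
  rewrite -setI_eq0; apply/eqP/setP => u; rewrite !inE; apply/negP => /andP[].
  case/imsetP => d; rewrite inE => /and3P[h1 h2 h3] ->.
  by rewrite up_of_i up_of_j => /andP[_ /eqP]; lia.
have cD : #|D| = k.
  have ht (t : 'I_k) : a + t + (b + k - t.+1) < n by move: (ltn_ord t); lia.
  pose f t := s2val (up_at (ht t)).
  have fi t : ui (f t) = a + t by rewrite /f; case: up_at.
  have fj t : uj (f t) = b + k - t.+1 by rewrite /f; case: up_at.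
  have finj : injective f.
    by move=> t t' e; apply: val_inj; have := fi t; rewrite e fi /=; lia.
  rewrite -[RHS]card_ord -(card_imset _ finj); congr #|pred_of_set _|.
  apply/setP => u; rewrite !inE; apply/idP/imsetP.
    move=> /andP[/and3P[h1 h2 h3] /eqP h4].
    have htk : ui u - a < k by lia.
    exists (Ordinal htk) => //; apply: uij_inj; rewrite ?fi ?fj /=; lia.
  by case=> t _ ->; rewrite fi fj; move: (ltn_ord t); lia.
rewrite eU cardsU; move: dis; rewrite -setI_eq0 => /eqP ->.
by rewrite cards0 subn0 cD card_imset //; apply: up_of_inj.
Qed.

Lemma card_up_down : #|up_triangle n| = #|down_triangle n| + n.
Proof.
have := @card_upsT 0 0 n (leqnn _); rewrite -!cardsT.
have -> : upsT 0 0 n = [set: up_triangle n].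
  by apply/setP => u; rewrite !inE /= add0n add0n uij_lt.
have -> // : downsT 0 0 n = [set: down_triangle n].
by apply/setP => d; rewrite !inE /= add0n add0n dij_lt.
Qed.

(** All neighbours of a downward triangle of a lattice triangle lie in that triangle, so [g] embeds
    [downsT a b k] in [upsT a b k :\: s], and [card_upsT] leaves at most [k] places for [s]. *)
Lemma matching_independent s (g : down_triangle n -> up_triangle n) :
  injective g -> (forall d, adj d (g d) && (g d \notin s)) -> independent s.
Proof.
move=> gi gP k a b k0 kn.
have := card_upsT kn; rewrite -(cardsID s (upsT a b k)) finset.setIC => e.
suff : #|downsT a b k| <= #|upsT a b k :\: s| by lia.
rewrite -(card_imset _ gi); apply: subset_leq_card; apply/fintype.subsetP => u.
case/imsetP => d; rewrite !inE => hd ->; have /andP[] := gP d.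
by rewrite /adj => h -> /=; lia.
Qed.

(** * Neighbourhoods and closed sets of downward triangles *)

Definition nb X : {set up_triangle n} := [set u | [exists d in X, adj d u]].

Lemma nbP X u : reflect (exists2 d, d \in X & adj d u) (u \in nb X).
Proof. by rewrite inE; apply: exists_inP. Qed.

Lemma nbU X X' : nb (X :|: X') = nb X :|: nb X'.
Proof.
apply/setP => u; apply/nbP/idP.
  by case=> d; rewrite !finset.in_setU => /orP[] dX a; apply/orP; [left|right]; apply/nbP; exists d.
by rewrite finset.in_setU => /orP[] /nbP[d dX a]; exists d => //; rewrite inE dX ?orbT.
Qed.

(** The bound [1 < k] matters: side 1 contains no downward triangle. For larger sides, a neighbour
    inside is the one with the same coordinates or, on the hypotenuse, the one to the left or (in
    the first column) below. *)
Lemma nb_downsT (a b k : nat) : 1 < k -> a + b + k <= n -> nb (downsT a b k) = upsT a b k.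
Proof.
move=> k1 kn; apply/setP => u; apply/nbP/idP.
  by case=> d; rewrite !inE /adj; lia.
rewrite inE => hu.
have [h|h] := ltnP (ui u + uj u + 1) (a + b + k).
  have [|d hi hj] := @down_at n (ui u) (uj u); first by lia.
  by exists d; rewrite ?inE /adj hi hj; lia.
have [h'|h'] := ltnP a (ui u).
  have [|d hi hj] := @down_at n ((ui u).-1) (uj u); first by lia.
  by exists d; rewrite ?inE /adj hi hj; lia.
have [|d hi hj] := @down_at n (ui u) ((uj u).-1); first by lia.
by exists d; rewrite ?inE /adj hi hj; lia.
Qed.

Definition closed_downs X : Prop :=
  forall d u v, u != v -> adj d u -> adj d v -> u \in nb X -> v \in nb X -> d \in X.

(** Membership by bare coordinates, here and in [up_in], lets a row be traversed without carrying
    bound proofs. *)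
Definition down_in X (i j : nat) : Prop := exists d, [/\ di d = i, dj d = j & d \in X].

Definition up_in Y (i j : nat) : Prop := exists u, [/\ ui u = i, uj u = j & u \in Y].

Lemma down_in_nb X i j : down_in X i j ->
  [/\ up_in (nb X) i j, up_in (nb X) i.+1 j & up_in (nb X) i j.+1].
Proof.
case=> d [hi hj dX]; have := dij_lt d.
have h i' j' : i' + j' < n ->
    [|| (i' == i) && (j' == j), (i' == i.+1) && (j' == j) | (i' == i) && (j' == j.+1)] ->
    up_in (nb X) i' j'.
  move=> /up_at[u ui' uj'] hij; exists u; split=> //; apply/nbP; exists d => //.
  by rewrite /adj ui' uj' hi hj.
by rewrite hi hj => lt; split; apply: h; lia.
Qed.

Lemma closed_down_in X i j : closed_downs X -> i + j + 1 < n ->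
  [\/ up_in (nb X) i j /\ up_in (nb X) i.+1 j,
      up_in (nb X) i j /\ up_in (nb X) i j.+1
    | up_in (nb X) i.+1 j /\ up_in (nb X) i j.+1] ->
  down_in X i j.
Proof.
move=> cX hij h; have [d hi hj] := down_at hij; exists d; split=> //.
case: h => [[]|[]|[]] [u [ui1 uj1 uX]] [v [vi1 vj1 vX]];
  (apply: (cX d u v) => //; first by [apply/eqP => e; move: ui1 uj1; rewrite e vi1 vj1; lia]);
  by rewrite /adj ?ui1 ?uj1 ?vi1 ?vj1 hi hj !eqxx ?orbT.
Qed.

(** Serves to spread membership in a closed set from one downward triangle, anywhere in a row, to
    the whole row. *)
Lemma interval_spread (P : nat -> Prop) (lo hi c : nat) :
  lo <= c < hi -> P c ->
  (forall t, lo <= t -> t.+1 < hi -> P t <-> P t.+1) ->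
  forall t, lo <= t < hi -> P t.
Proof.
move=> hc Pc st.
have up t : c + t < hi -> P (c + t).
  elim: t => [|t IH] ht; first by rewrite addn0.
  have [h1 _] := st (c + t) ltac:(lia) ltac:(lia).
  by rewrite addnS; apply: h1; apply: IH; lia.
have dn t : t <= c - lo -> P (c - t).
  elim: t => [|t IH] ht; first by rewrite subn0.
  have [_ h2] := st (c - t.+1) ltac:(lia) ltac:(lia); apply: h2.
  have -> : (c - t.+1).+1 = c - t by lia.
  by apply: IH; lia.
move=> t ht; have [h|h] := leqP c t.
  by rewrite -(subnKC h); apply: up; lia.
have -> : t = c - (c - t) by lia.
by apply: dn; lia.
Qed.

(** [d] sits just outside one side. Consecutive downward triangles of the row along that side share
    an upward triangle, and each has another neighbour inside the lattice triangle, so closedness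
    carries membership along the row. Adding the row gives a lattice triangle of side [k + 1]. *)
Lemma downsT_grow X a b k d u :
  closed_downs X -> 1 < k -> a + b + k <= n -> downsT a b k \subset X ->
  d \in X -> d \notin downsT a b k -> u \in upsT a b k -> adj d u ->
  exists a' b', a' + b' + k.+1 <= n /\ downsT a' b' k.+1 \subset X.
Proof.
move=> cX k1 kn sT dX dT uT du.
have inT i j : a <= i -> b <= j -> i + j < a + b + k -> up_in (nb X) i j.
  move=> h1 h2 h3; have [|v vi vj] := @up_at n i j; first by lia.
  exists v; split=> //; have : v \in nb (downsT a b k).
    by rewrite nb_downsT // inE vi vj h1 h2 h3.
  by case/nbP => e eT av; apply/nbP; exists e => //; apply: (fintype.subsetP sT).
have Xd : down_in X (di d) (dj d) by exists d.
have oldX e : e \in downsT a b k -> e \in X by apply: (fintype.subsetP sT).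
have newX e i j : down_in X i j -> di e = i -> dj e = j -> e \in X.
  by case=> f [fi fj fX] ei ej; have -> : e = f by apply: dij_inj; lia.
have lt := dij_lt d; rewrite !inE in dT uT.
(* Here [d] lies in column [a - 1], and the corner moves to [(a - 1, b)]; the case [dj d < b] is
   symmetric. *)
have [h|h] := ltnP (di d) a.
  have row t : b <= t < b + k -> down_in X (di d) t.
    apply: (@interval_spread _ _ _ (dj d)) => //; first by rewrite /adj in du; lia.
    move=> {}t h1 h2; split=> /down_in_nb[n1 n2 n3]; apply: closed_down_in => //;
      rewrite /adj in du; try lia.
      by constructor 1; split=> //; apply: inT; lia.
    by constructor 3; split=> //; apply: inT; lia.
  exists (di d), b; split; first by rewrite /adj in du; lia.
  apply/fintype.subsetP => e; rewrite inE => he.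
  have [he'|he'] := leqP a (di e); first by apply: oldX; rewrite inE; rewrite /adj in du; lia.
  by apply: (newX e (di d) (dj e)) => //; [apply: row|]; rewrite /adj in du; lia.
have [h'|h'] := ltnP (dj d) b.
  have row t : a <= t < a + k -> down_in X t (dj d).
    apply: (@interval_spread (fun t => down_in X t (dj d)) _ _ (di d)) => //.
      by rewrite /adj in du; lia.
    move=> {}t h1 h2; split=> /down_in_nb[n1 n2 n3]; apply: closed_down_in => //;
      rewrite /adj in du; try lia.
      by constructor 2; split=> //; apply: inT; lia.
    by constructor 3; split=> //; apply: inT; lia.
  exists a, (dj d); split; first by rewrite /adj in du; lia.
  apply/fintype.subsetP => e; rewrite inE => he.
  have [he'|he'] := leqP b (dj e); first by apply: oldX; rewrite inE; rewrite /adj in du; lia.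
  by apply: (newX e (di e) (dj d)) => //; [apply: row|]; rewrite /adj in du; lia.
(* Beyond the hypotenuse the corner stays, and the row consists of the triangles with coordinate sum
   [a + b + k - 1]. *)
have row t : a <= t < a + k -> down_in X t (a + b + k - 1 - t).
  apply: (@interval_spread (fun t => down_in X t (a + b + k - 1 - t)) _ _ (di d)) => //.
  - by rewrite /adj in du; lia.
  - by have -> : a + b + k - 1 - di d = dj d by rewrite /adj in du; lia.
  move=> {}t h1 h2; have -> : a + b + k - 1 - t = (a + b + k - 1 - t.+1).+1 by lia.
  split=> /down_in_nb[n1 n2 n3]; apply: closed_down_in => //; try by rewrite /adj in du; lia.
    by constructor 2; split=> //; apply: inT; lia.
  by constructor 1; split=> //; apply: inT; lia.
exists a, b; split; first by rewrite /adj in du; lia.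
apply/fintype.subsetP => e; rewrite inE => he.
have [he'|he'] := ltnP (di e + dj e + 1) (a + b + k); first by apply: oldX; rewrite inE; lia.
by apply: (newX e (di e) (a + b + k - 1 - di e)) => //; [apply: row|]; lia.
Qed.

(** * The deficiency inequality *)

(** Labels the three neighbours of [d] by 0, 1, 2, so that counting among them becomes
    arithmetic. *)
Definition slot d u : nat := (ui u - di d) + 2 * (uj u - dj d).

Lemma slot_le2 d u : adj d u -> slot d u <= 2.
Proof. by rewrite /slot; case/or3P => /andP[/eqP -> /eqP ->]; lia. Qed.

Lemma slot_inj d u v : adj d u -> adj d v -> slot d u = slot d v -> u = v.
Proof.
rewrite /slot => du dv uv; apply: uij_inj;
  case/or3P: du uv => /andP[/eqP -> /eqP ->];
  by case/or3P: dv => /andP[/eqP -> /eqP ->]; lia.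
Qed.

(** As long as an outside element of [X] touches the lattice triangle, [downsT_grow] enlarges it;
    the side is bounded by [n], so this stops. *)
Lemma closed_downs_component X d0 : closed_downs X -> d0 \in X ->
  exists a b k, [/\ 1 < k, a + b + k <= n, downsT a b k \subset X &
    forall d u, d \in X -> d \notin downsT a b k -> u \in upsT a b k -> ~~ adj d u].
Proof.
move=> cX d0X.
have grow m a b k : n - k <= m -> 1 < k -> a + b + k <= n -> downsT a b k \subset X ->
    exists a b k, [/\ 1 < k, a + b + k <= n, downsT a b k \subset X &
    forall d u, d \in X -> d \notin downsT a b k -> u \in upsT a b k -> ~~ adj d u].
  elim: m a b k => [|m IH] a b k hm k1 kn sT; have [[d [u [dX dT uT du]]]|iso] :=
    EM (exists d u, [/\ d \in X, d \notin downsT a b k, u \in upsT a b k & adj d u]).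
  - by have [a' [b' [kn' _]]] := downsT_grow cX k1 kn sT dX dT uT du; lia.
  - exists a, b, k; split=> // d u dX dT uT; apply/negP => du.
    by apply: iso; exists d, u.
  - have [a' [b' [kn' sT']]] := downsT_grow cX k1 kn sT dX dT uT du.
    by apply: (IH a' b' k.+1) => //; lia.
  - exists a, b, k; split=> // d u dX dT uT; apply/negP => du.
    by apply: iso; exists d, u.
(* The starting triangle, of side 2, has [d0] as its only downward triangle. *)
have lt := dij_lt d0; apply: (grow n (di d0) (dj d0) 2); try lia.
apply/fintype.subsetP => e; rewrite inE => he.
by have -> : e = d0 by apply: dij_inj; lia.
Qed.

(** Induction on [#|X|]. The component split off adds [#|downsT a b k| + k] to [#|nb X|] and at most
    [k] to [#|nb X :&: s|], so the inequality for the remainder [X'] suffices. *)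
Lemma closed_downs_deficiency s X : independent s -> closed_downs X ->
  #|X| + #|nb X :&: s| <= #|nb X|.
Proof.
move=> ind; have [m] := ubnP #|X|; elim: m => // m IH in X * => leX cX.
have [->|[d0 d0X]] := set_0Vmem X.
  have -> : nb finset.set0 = finset.set0.
    by apply/setP => u; rewrite finset.in_set0; apply/nbP => -[d]; rewrite finset.in_set0.
  by rewrite finset.set0I !cards0.
have [a [b [k [k1 kn sT iso]]]] := closed_downs_component cX d0X.
pose X' := X :\: downsT a b k.
have eX : X = downsT a b k :|: X'.
  apply/setP => d; rewrite !inE; case: (boolP (_ && _)) => //= h.
  by apply: (fintype.subsetP sT); rewrite inE.
have nX' u : u \in nb X' -> u \notin upsT a b k.
  case/nbP => d; rewrite finset.in_setD => /andP[dT dX] du; apply/negP => uT.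
  by have := iso d u dX dT uT; rewrite du.
have nbX : nb X = upsT a b k :|: nb X' by rewrite {1}eX nbU nb_downsT.
have dis (B : {set up_triangle n}) : B \subset nb X' -> #|upsT a b k :&: B| = 0.
  move=> sB; apply/eqP; rewrite cards_eq0; apply/eqP/setP => u; rewrite !inE.
  apply/negP => /andP[uT /(fintype.subsetP sB)/nX']; rewrite inE; by rewrite uT.
have cN : #|nb X| = #|upsT a b k| + #|nb X'| by rewrite nbX cardsU dis // subn0.
have cNs : #|nb X :&: s| <= k + #|nb X' :&: s|.
  rewrite nbX finset.setIUl; apply: leq_trans (leq_card_setU _ _) _.
  by rewrite leq_add2r finset.setIC; apply: ind => //; lia.
have cX2 : #|X| = #|downsT a b k| + #|X'|.
  rewrite {1}eX cardsU -[RHS]subn0; congr (_ - _).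
  apply/eqP; rewrite cards_eq0; apply/eqP/setP => d; rewrite !inE.
  by case: [&& a <= di d, _ & _]; rewrite ?andbF.
have cT := card_upsT kn.
have [|e hi hj] := @down_at n a b; first by lia.
have T0 : 0 < #|downsT a b k|.
  by apply/card_gt0P; exists e; rewrite inE hi hj; lia.
suff : #|X'| + #|nb X' :&: s| <= #|nb X'| by lia.
apply: IH; first by lia.
(* [X'] is again closed: a triangle in [downsT a b k] has all its neighbours in [upsT a b k], which
   [nb X'] avoids. *)
move=> d u v uv du dv uX vX.
have dX : d \in X by apply: (cX d u v) => //; rewrite nbX inE ?uX ?vX orbT.
rewrite finset.in_setD dX andbT; apply: contraTN du => dT.
apply: contraL uX => du; apply/negP => /nX' /negP; apply.
by rewrite -nb_downsT //; apply/nbP; exists d.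
Qed.

(** Induction on the complement of [X]. Adding [d] with two neighbours in [nb X] raises [#|X|] by
    one and [#|nb X|] by at most one, and does not lower [#|nb X :&: s|]; the inequality thus
    descends from [d |: X] to [X]. *)
Lemma deficiency s X : independent s -> #|X| + #|nb X :&: s| <= #|nb X|.
Proof.
move=> ind; have [m] := ubnP #|~: X|; elim: m => // m IH in X * => leX.
have [[d [u [v [[uv du dv] [uX vX] dX]]]]|cX] := EM (exists d u v,
  [/\ [/\ u != v, adj d u & adj d v], u \in nb X /\ v \in nb X & d \notin X]); last first.
  apply: closed_downs_deficiency => // d u v uv du dv uX vX.
  by apply/negPn/negP => dX; apply: cX; exists d, u, v.
have cX : #|d |: X| = #|X|.+1 by rewrite cardsU1 dX.
have lt : #|~: (d |: X)| < m by have := cardsC X; have := cardsC (d |: X); lia.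
have := IH _ lt.
have sub : #|nb (d |: X)| <= #|nb X|.+1.
  (* Of the three slots of [d], two are taken by [u] and [v], so [W] has at most one element. *)
  pose W := [set w | adj d w] :\: [set u; v].
  have W1 : #|W| <= 1.
    apply/card_le1_eqP => w w'; rewrite !inE !negb_or.
    move=> /andP[/andP[wu wv] dw] /andP[/andP[wu' wv'] dw'].
    have ne x y : x != y -> adj d x -> adj d y -> slot d x != slot d y.
      by move=> xy dx dy; apply: contraNneq xy => /(slot_inj dx dy) ->.
    apply: (slot_inj dw' dw).
    move: (ne _ _ uv du dv) (ne _ _ wu dw du) (ne _ _ wv dw dv)
      (ne _ _ wu' dw' du) (ne _ _ wv' dw' dv)
      (slot_le2 du) (slot_le2 dv) (slot_le2 dw) (slot_le2 dw').
    by move: (slot d u) (slot d v) (slot d w) (slot d w') =>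
      [|[|[|?]]] [|[|[|?]]] [|[|[|?]]] [|[|[|?]]].
  have /subset_leq_card : nb (d |: X) \subset nb X :|: W.
    apply/fintype.subsetP => w; rewrite nbU finset.in_setU => /orP[/nbP[e]|wX].
      rewrite inE => /eqP -> dw.
      have [->|wu] := eqVneq w u; first by rewrite finset.in_setU uX.
      have [->|wv] := eqVneq w v; first by rewrite finset.in_setU vX.
      by rewrite finset.in_setU; apply/orP; right; rewrite !inE negb_or wu wv dw.
    by rewrite finset.in_setU wX.
  by move/leq_trans; apply; apply: leq_trans (leq_card_setU _ _) _; lia.
have : #|nb X :&: s| <= #|nb (d |: X) :&: s|.
  by apply: subset_leq_card; apply: finset.setSI; rewrite nbU finset.subsetUr.
lia.
Qed.

(** * Assignments with one or two triangles each *)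

Definition nbd Y : {set down_triangle n} := [set d | [exists u in Y, adj d u]].

Lemma nbdP Y d : reflect (exists2 u, u \in Y & adj d u) (d \in nbd Y).
Proof. by rewrite inE; apply: exists_inP. Qed.

(* Off the hypotenuse a triangle goes to the downward triangle of the same
   coordinates, and on it to its left neighbour; the corner [(0, n - 1)] has
   only the neighbour [(0, n - 2)], which is freed by moving [(0, n - 2)] down. *)
Lemma adj_two_to_one : 2 < n ->
  exists2 h : up_triangle n -> down_triangle n * bool,
    injective h & forall u, adj (h u).1 u.
Proof.
move=> n2.
pose hij u : nat * nat :=
  if ui u + uj u + 1 < n then
    if (ui u == 0) && (uj u == n - 2) then (0, n - 3) else (ui u, uj u)
  else if ui u == 0 then (0, n - 2) else ((ui u).-1, uj u).
have hP u : (hij u).1 + (hij u).2 + 1 < n.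
  have := uij_lt u; rewrite /hij.
  by case: ifP => h1; case: ifP => h2 /=; lia.
pose h u := s2val (down_at (hP u)).
have hi u : di (h u) = (hij u).1 by rewrite /h; case: down_at.
have hj u : dj (h u) = (hij u).2 by rewrite /h; case: down_at.
(* The tag separates the two preimages of a downward triangle: it marks [(0, n - 2)] and the
   hypotenuse except [(0, n - 1)], which takes the untagged place given up by [(0, n - 2)]. *)
pose tag u := (ui u == 0) && (uj u == n - 2) || (ui u + uj u + 1 == n) && (ui u != 0).
exists (fun u => (h u, tag u)).
  move=> u v [huv tuv]; have := hi u; have := hj u; rewrite huv hi hj /hij.
  have := uij_lt u; have := uij_lt v; move: tuv; rewrite /tag => tuv ltu ltv.
  by case: ifP => h1; case: ifP => h2; case: ifP => h3; case: ifP => h4 /= e1 e2;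
    apply: uij_inj; lia.
move=> u; rewrite /adj hi hj /hij; have := uij_lt u.
by case: ifP => h1; case: ifP => h2 /=; lia.
Qed.

(** For [n > 2] this is [adj_two_to_one]. For [n <= 2] there are [n - 1] downward triangles, and the
    nonempty [s] leaves at most two upward triangles if [n = 2] and none if [n = 1]. *)
Lemma leq_card_nbd s Y : 0 < n -> ~ (n <= 2 /\ #|s| = 0) ->
  [disjoint Y & s] -> #|Y| <= 2 * #|nbd Y|.
Proof.
move=> n0 hex dis; have [n2|n2] := ltnP 2 n.
  have [h hinj ha] := adj_two_to_one n2.
  have B2 : #|[set: bool]| = 2 by rewrite cardsT card_bool.
  rewrite -(card_imset Y hinj) mulnC -B2 -cardsX.
  apply: subset_leq_card; apply/fintype.subsetP => p /imsetP[u uY ->].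
  have := ha u; case: (h u) => d b du; rewrite finset.in_setX finset.in_setT andbT.
    by apply/nbdP; exists u.
have [->|[u uY]] := set_0Vmem Y; first by rewrite cards0.
have s0 : 0 < #|s| by rewrite lt0n; apply/eqP => s0; apply: hex.
have D1 : #|down_triangle n| = n.-1.
  case: (posnP n.-1) => n1.
    by rewrite n1; apply: eq_card0 => d; have := dij_lt d; lia.
  have [|d _ _] := @down_at n 0 0; first by lia.
  have -> : n.-1 = 1 by lia.
  rewrite -cardsT; apply/eqP/cards1P; exists d; apply/setP => e; rewrite !inE.
  by apply/esym/eqP/dij_inj; move: (dij_lt d) (dij_lt e); lia.
have := max_card (Y :|: s); rewrite cardsU; move: dis; rewrite -setI_eq0 => /eqP ->.
rewrite cards0 card_up_down D1 => le.
have u0 : 0 < #|Y| by apply/card_gt0P; exists u.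
have [|d hi hj] := @down_at n 0 0; first by lia.
suff : 0 < #|nbd Y| by lia.
apply/card_gt0P; exists d; apply/nbdP; exists u => //.
by rewrite /adj hi hj; move: (uij_lt u); lia.
Qed.

Lemma independent_leq s : 0 < n -> independent s -> #|s| <= n.
Proof.
move=> n0 /(_ n 0 0 n0 (leqnn _)).
have -> : upsT 0 0 n = [set: up_triangle n]; last by rewrite finset.setIT.
by apply/setP => u; rewrite !inE /= add0n add0n uij_lt.
Qed.

(** Let [X] be the complement of [nbd Y]. Then [Y], [s] and [nb X :\: s] are disjoint among the
    [#|down_triangle n| + n] upward triangles, and [deficiency] bounds [#|X|] by the size of the
    third. *)
Lemma leq_card_nbd_deficit s Y : 0 < n -> independent s -> [disjoint Y & s] ->
  #|Y| + #|s| <= #|nbd Y| + n.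
Proof.
move=> n0 ind dis; have := deficiency (~: nbd Y) ind.
have := cardsC (nbd Y); set X := ~: nbd Y.
have dis' : [disjoint Y :|: s & nb X :\: s].
  rewrite -setI_eq0; apply/eqP/setP => u.
  rewrite finset.in_set0 finset.in_setI finset.in_setU finset.in_setD.
  apply/negP => /andP[/orP[uY|->//] /andP[us /nbP[d dX du]]].
  by move: dX; rewrite finset.in_setC => /negP; apply; apply/nbdP; exists u.
have := cardsU (Y :|: s) (nb X :\: s); have := cardsU Y s.
move: dis dis'; rewrite -!setI_eq0 => /eqP -> /eqP ->; rewrite cards0.
have := max_card ((Y :|: s) :|: (nb X :\: s)); have := cardsID s (nb X).
have := card_up_down; lia.
Qed.

Lemma independent_assignment s : 0 < n -> ~ (n <= 2 /\ #|s| = 0) -> independent s ->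
  exists F : down_triangle n -> {set up_triangle n},
    [/\ forall d u, u \in F d -> adj d u /\ u \notin s,
        forall u, u \notin s -> exists d, u \in F d,
        forall d e u, u \in F d -> u \in F e -> d = e,
        forall d, 1 <= #|F d| <= 2
      & #|[set d | #|F d| == 2]| + #|s| = n].
Proof.
move=> n0 hex ind.
have sn := independent_leq n0 ind.
have cS : #|{: {u | u \notin s}}| = #|~: s|.
  by rewrite card_sig; apply: eq_card => u; rewrite !inE.
have cU := card_up_down; have cC := cardsC s.
have mD : n - #|s| <= #|down_triangle n|.
  have dis : [disjoint ~: s & s] by rewrite -setI_eq0 finset.setIC finset.setICr.
  have := leq_card_nbd n0 hex dis; have := max_card (nbd (~: s)); lia.
(* The number of dummies makes [#|L| = #|R|]; by [mD] the subtraction is not truncated. *)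
pose k := #|down_triangle n| - (n - #|s|).
pose L : finType := ({u | u \notin s} + 'I_k)%type.
pose R : finType := (down_triangle n * bool)%type.
pose E (x : L) : {set R} := match x with
  | inl u => [set p : R | adj p.1 (val u)] | inr _ => [set p : R | p.2] end.
have hE : hall E.
  move=> Y.
  pose Y1 := [set u | inl u \in Y]; pose Y2 := [set z | inr z \in Y].
  have cY : #|Y| = #|val @: Y1| + #|Y2|.
    rewrite (card_imset _ val_inj).
    pose il : {u | u \notin s} -> L := inl; pose ir : 'I_k -> L := inr.
    have ilI : injective il by apply: inl_inj.
    have irI : injective ir by apply: inr_inj.
    rewrite -(card_imset Y1 ilI) -(card_imset Y2 irI) -[RHS]subn0.
    have <- : #|il @: Y1 :&: ir @: Y2| = 0.
      by apply/eqP; rewrite cards_eq0; apply/eqP/setP => -[u|z]; rewrite !inE;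
        apply/negP => /andP[/imsetP[? _ e1] /imsetP[? _ e2]].
    rewrite -cardsU; congr #|pred_of_set _|; apply/setP => -[u|z]; rewrite finset.in_setU.
      by rewrite (mem_imset _ _ ilI) inE orbC; case: imsetP => // -[].
    by rewrite (mem_imset _ _ irI) inE; case: imsetP => // -[].
  have dis : [disjoint val @: Y1 & s].
    rewrite -setI_eq0; apply/eqP/setP => u; rewrite !inE; apply/negP => /andP[].
    by case/imsetP => v _ ->; rewrite (negPf (valP v)).
  have cov d b : d \in nbd (val @: Y1) -> (d, b) \in \bigcup_(x in Y) E x.
    case/nbdP => _ /imsetP[v vY ->] a; apply/finset.bigcupP.
    exists (inl v); rewrite inE in vY => //.
    by rewrite inE.
  (* Without dummies the two-to-one bound applies. A single dummy already reaches every [(d, true)],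
     and the deficit bound handles the rest. *)
  have [Y20|[z zY]] := set_0Vmem Y2.
    rewrite cY Y20 cards0 addn0; apply: leq_trans (leq_card_nbd n0 hex dis) _.
    have B2 : #|[set: bool]| = 2 by rewrite cardsT card_bool.
    rewrite mulnC -B2 -cardsX; apply: subset_leq_card.
    by apply/fintype.subsetP => -[d b]; rewrite finset.in_setX => /andP[/cov].
  have hT : finset.setX [set: down_triangle n] [set true] :|:
            finset.setX (nbd (val @: Y1)) [set false] \subset \bigcup_(x in Y) E x.
    apply/fintype.subsetP => -[d b]; rewrite finset.in_setU !finset.in_setX.
    case/orP => /andP[h1 h2]; last exact: cov.
    apply/finset.bigcupP; exists (inr z); rewrite inE in zY => //.
    by rewrite inE /=; move: h2; rewrite inE => /eqP.
  apply: leq_trans (subset_leq_card hT); rewrite cardsU !cardsX !cards1 cardsT.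
  have -> : #|finset.setX [set: down_triangle n] [set true] :&:
            finset.setX (nbd (val @: Y1)) [set false]| = 0.
    apply/eqP; rewrite cards_eq0; apply/eqP/setP => -[d b]; rewrite !inE.
    by case: b; rewrite ?andbF.
  have := leq_card_nbd_deficit n0 ind dis; have := max_card Y2; rewrite card_ord; lia.
have [g ginj gE] := hall_marriage hE.
have cLR : #|L| = #|R|.
  by rewrite card_sum card_prod card_bool card_ord cS; lia.
have gonto r : r \in codom g by apply: inj_card_onto; rewrite ?cLR.
pose f (v : {u | u \notin s}) := (g (inl v)).1.
pose V d := [set v | f v == d].
have cV d : #|val @: V d| = #|V d| by rewrite (card_imset _ val_inj).
(* As [g] is onto and dummies avoid [(d, false)], that copy is taken by an upward triangle, whence
   the lower bound. *)
have V12 d : 1 <= #|V d| <= 2.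
  apply/andP; split.
    have /codomP[[v|z] e] := gonto (d, false).
      by apply/card_gt0P; exists v; rewrite inE /f -e.
    by have := gE (inr z); rewrite -e inE.
  rewrite -card_bool -(@card_in_imset _ _ (fun v : {u | u \notin s} => (g (inl v)).2)).
    exact: max_card.
  move=> v w; rewrite !inE /f => /eqP dv /eqP dw e.
  have /ginj [] // : g (inl v) = g (inl w).
  by rewrite [LHS]surjective_pairing [RHS]surjective_pairing dv dw e.
have sumV : \sum_d #|V d| = #|~: s|.
  rewrite -cS -sum1_card (partition_big f predT) //=.
  by apply: eq_bigr => d _; rewrite -sum1_card; apply: eq_bigl => v; rewrite inE.
exists (fun d => val @: V d); split.
- move=> d _ /imsetP[v vV ->]; split; last exact: (valP v).
  by have := gE (inl v); rewrite inE in vV; rewrite inE -/(f v) (eqP vV).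
- move=> u us; exists (f (Sub u us)); apply/imsetP; exists (Sub u us) => //.
  by rewrite inE.
- move=> d e u /imsetP[v vd ->] /imsetP[w we /val_inj vw].
  by rewrite !inE -?vw in vd we; rewrite -(eqP vd) -(eqP we).
- by move=> d; rewrite cV.
have sum2 : \sum_d #|V d| = #|down_triangle n| + #|[set d | #|val @: V d| == 2]|.
  have -> : #|[set d | #|val @: V d| == 2]| = \sum_d (#|val @: V d| == 2).
    by rewrite -sum1_card big_mkcond; apply: eq_bigr => d _; rewrite inE; case: eqP.
  rewrite -sum1_card -big_split /=; apply: eq_bigr => d _; rewrite cV; have := V12 d.
  by case: #|V d| => [|[|[|]]].
lia.
Qed.

End Combinatorics.

Local Open Scope classical_set_scope.
Local Open Scope card_scope.

Section Geometry.
Local Open Scope ring_scope.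

(** * Geometry of the cells *)

Section Coordinates.
Variable R : realType.
Implicit Types x y a b c d : plane R.

(* Coordinates in the basis [e1 = (1, 0)], [e2 = (1/2, sqrt 3 / 2)]. *)
Definition ca x : R := x.1 - x.2 / Num.sqrt 3.
Definition cb x : R := x.2 * (2 / Num.sqrt 3).
Definition mkp (s t : R) : plane R := (s + t / 2, t * (Num.sqrt 3 / 2)).

Lemma sqrt3_neq0 : Num.sqrt 3 != 0 :> R.
Proof. by rewrite sqrtr_eq0 -ltNge. Qed.

Lemma ca_mkp s t : ca (mkp s t) = s.
Proof. by rewrite /ca /mkp /=; field; rewrite sqrt3_neq0. Qed.

Lemma cb_mkp s t : cb (mkp s t) = t.
Proof. by rewrite /cb /mkp /=; field; rewrite sqrt3_neq0. Qed.

Lemma mkp_ca_cb x : mkp (ca x) (cb x) = x.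
Proof.
by rewrite /ca /cb /mkp [RHS]surjective_pairing; congr pair; field; rewrite sqrt3_neq0.
Qed.

Lemma coord_inj x y : ca x = ca y -> cb x = cb y -> x = y.
Proof. by move=> h1 h2; rewrite -(mkp_ca_cb x) h1 h2 mkp_ca_cb. Qed.

Lemma lpointE p : lpoint R p = mkp p.1%:R p.2%:R.
Proof. by []. Qed.

Lemma caD x y : ca (x + y) = ca x + ca y.
Proof. by rewrite /ca /=; ring. Qed.

Lemma cbD x y : cb (x + y) = cb x + cb y.
Proof. by rewrite /cb /=; ring. Qed.

Lemma caB x y : ca (x - y) = ca x - ca y.
Proof. by rewrite /ca /=; ring. Qed.

Lemma cbB x y : cb (x - y) = cb x - cb y.
Proof. by rewrite /cb /=; ring. Qed.

Lemma caZ t x : ca (t *: x) = t * ca x.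
Proof. by rewrite /ca /= /GRing.scale /=; ring. Qed.

Lemma cbZ t x : cb (t *: x) = t * cb x.
Proof. by rewrite /cb /= /GRing.scale /=; ring. Qed.

(** Eliminating the weight of [a] leaves an affine parametrisation, amenable to linear
    arithmetic. *)
Lemma hull3P a b c x :
  hull [:: a; b; c] x <-> exists u v : R, [/\ 0 <= u, 0 <= v & u + v <= 1] /\
    (ca x = ca a + u * (ca b - ca a) + v * (ca c - ca a) /\
     cb x = cb a + u * (cb b - cb a) + v * (cb c - cb a)).
Proof.
split=> [[w [w0 w1 ->]]|[u [v [[u0 v0 uv] [xa xb]]]]].
  exists (w (lift ord0 ord0)), (w (lift ord0 (lift ord0 ord0))).
  move: w1; rewrite !big_ord_recl big_ord0 /= addr0 => w1.
  have := w0 ord0; have := w0 (lift ord0 ord0); have := w0 (lift ord0 (lift ord0 ord0)).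
  move=> h1 h2 h3.
  have -> : w ord0 = 1 - w (lift ord0 ord0) - w (lift ord0 (lift ord0 ord0)) by lra.
  rewrite big_ord0 addr0 !caD !cbD !caZ !cbZ.
  by split; [split; lra|split; ring].
exists (fun i => nth 0 [:: 1 - u - v; u; v] i); split.
- by case=> -[|[|[|]]] //= _; lra.
- by rewrite !big_ord_recl big_ord0 /=; lra.
- rewrite !big_ord_recl big_ord0 /= addr0; apply: coord_inj.
    by rewrite !caD !caZ xa; ring.
  by rewrite !cbD !cbZ xb; ring.
Qed.

Lemma hull4P a b c d x :
  hull [:: a; b; c; d] x <-> exists u v w : R,
    [/\ 0 <= u, 0 <= v, 0 <= w & u + v + w <= 1] /\
    (ca x = ca a + u * (ca b - ca a) + v * (ca c - ca a) + w * (ca d - ca a) /\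
     cb x = cb a + u * (cb b - cb a) + v * (cb c - cb a) + w * (cb d - cb a)).
Proof.
split=> [[w [w0 w1 ->]]|[u [v [w [[u0 v0 w0 uv] [xa xb]]]]]].
  exists (w (lift ord0 ord0)), (w (lift ord0 (lift ord0 ord0))),
    (w (lift ord0 (lift ord0 (lift ord0 ord0)))).
  move: w1; rewrite !big_ord_recl big_ord0 /= addr0 => w1.
  have := w0 ord0; have := w0 (lift ord0 ord0); have := w0 (lift ord0 (lift ord0 ord0)).
  have := w0 (lift ord0 (lift ord0 (lift ord0 ord0))).
  move=> h0 h1 h2 h3.
  have -> : w ord0 = 1 - w (lift ord0 ord0) - w (lift ord0 (lift ord0 ord0)) -
    w (lift ord0 (lift ord0 (lift ord0 ord0))) by lra.
  rewrite big_ord0 addr0 !caD !cbD !caZ !cbZ.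
  by split; [split; lra|split; ring].
exists (fun i => nth 0 [:: 1 - u - v - w; u; v; w] i); split.
- by case=> -[|[|[|[|]]]] //= _; lra.
- by rewrite !big_ord_recl big_ord0 /=; lra.
- rewrite !big_ord_recl big_ord0 /= addr0; apply: coord_inj.
    by rewrite !caD !caZ xa; ring.
  by rewrite !cbD !cbZ xb; ring.
Qed.

Lemma hull_convex vs x y t : 0 <= t <= 1 -> hull vs x -> hull vs y ->
  hull vs (x + t *: (y - x)).
Proof.
move=> /andP[t0 t1] [w [w0 w1 ->]] [v [v0 v1 ->]].
exists (fun i => (1 - t) * w i + t * v i); split.
- by move=> i; rewrite addr_ge0 // mulr_ge0 // subr_ge0.
- by rewrite big_split /= -!mulr_sumr w1 v1; ring.
- under [RHS]eq_bigr do rewrite scalerDl -!scalerA.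
  rewrite big_split /= -!scaler_sumr scalerBr scalerBl scale1r.
  by rewrite addrA addrAC.
Qed.

Lemma utriangleP k i j x : (0 < k)%N ->
  utriangle R k i j x <-> [/\ i%:R <= ca x, j%:R <= cb x & ca x + cb x <= (i + j + k)%:R].
Proof.
move=> k0; have k0' : (0 : R) < k%:R by rewrite ltr0n.
rewrite /utriangle /= hull3P !lpointE !ca_mkp !cb_mkp /= !natrD; split.
  move=> [u [v [[u0 v0 uv] [-> ->]]]].
  have := mulr_ge0 u0 (ltW k0'); have := mulr_ge0 v0 (ltW k0').
  have : 0 <= (1 - u - v) * k%:R by apply: mulr_ge0; [lra|exact: ltW].
  by split; lra.
move=> [h1 h2 h3]; exists ((ca x - i%:R) / k%:R), ((cb x - j%:R) / k%:R); split.
  split; first by apply: divr_ge0; lra.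
    by apply: divr_ge0; lra.
  by rewrite -mulrDl ler_pdivrMr //; lra.
by split; field; rewrite gt_eqF.
Qed.

End Coordinates.

Section Cells.
Variables (R : realType) (n : nat).
Implicit Types (x y : plane R) (t : unit_triangle n).

Definition open_cell t : set (plane R) := fun x =>
  match t with
  | inl u => [/\ (ui u)%:R < ca x, (uj u)%:R < cb x & ca x + cb x < (ui u + uj u).+1%:R]
  | inr d => [/\ ca x < (di d).+1%:R, cb x < (dj d).+1%:R & (di d + dj d).+1%:R < ca x + cb x]
  end.

Lemma up_cellP (u : up_triangle n) x : cell (inl u) x <->
  [/\ (ui u)%:R <= ca x, (uj u)%:R <= cb x & ca x + cb x <= (ui u + uj u).+1%:R].
Proof.
rewrite /cell /= hull3P !lpointE !ca_mkp !cb_mkp /= -/(ui u) -/(uj u).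
rewrite -!natr1 natrD; split.
  by move=> [s [t [[s0 t0 st] [-> ->]]]]; split; lra.
move=> [h1 h2 h3]; exists (ca x - (ui u)%:R), (cb x - (uj u)%:R).
by split; [split|split]; lra.
Qed.

Lemma down_cellP (d : down_triangle n) x : cell (inr d) x <->
  [/\ ca x <= (di d).+1%:R, cb x <= (dj d).+1%:R & (di d + dj d).+1%:R <= ca x + cb x].
Proof.
rewrite /cell /= hull3P !lpointE !ca_mkp !cb_mkp /= -/(di d) -/(dj d).
rewrite -!natr1 natrD; split.
  by move=> [s [t [[s0 t0 st] [-> ->]]]]; split; lra.
move=> [h1 h2 h3].
exists ((di d)%:R + 1 - ca x), (ca x + cb x - (di d)%:R - (dj d)%:R - 1).
by split; [split|split]; lra.
Qed.

Lemma open_cellW t : open_cell t `<=` cell t.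
Proof.
case: t => [u|d] x [h1 h2 h3]; [apply/up_cellP|apply/down_cellP]; by split; apply: ltW.
Qed.

(** The strict bounds of one cell and the weak bounds of the other combine to integer inequalities
    between the corners, which force equality or, for opposite orientations, a contradiction. *)
Lemma open_cell_inj t t' x : open_cell t x -> cell t' x -> t = t'.
Proof.
case: t t' => [u|d] [u'|d'] [h1 h2 h3].
- move/up_cellP => [k1 k2 k3]; congr inl.
  have : [/\ ui u' < (ui u).+1, uj u' < (uj u).+1 & ui u + uj u < (ui u' + uj u').+1]%N.
    by rewrite -!(ltr_nat R); move: h3 k3; rewrite -!natr1 !natrD => h3 k3; split; lra.
  by case=> *; apply: uij_inj; lia.
- move/down_cellP => [k1 k2 k3].
  suff : [/\ ui u < (di d').+1, uj u < (dj d').+1 & di d' + dj d' < ui u + uj u]%N by case; lia.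
  by rewrite -!(ltr_nat R); move: h3 k1 k2 k3; rewrite -!natr1 !natrD => h3 k1 k2 k3; split; lra.
- move/up_cellP => [k1 k2 k3].
  suff : [/\ ui u' < (di d).+1, uj u' < (dj d).+1 & di d + dj d < ui u' + uj u']%N by case; lia.
  by rewrite -!(ltr_nat R); move: h1 h2 h3 k3; rewrite -!natr1 !natrD => h1 h2 h3 k3; split; lra.
- move/down_cellP => [k1 k2 k3]; congr inr.
  have : [/\ di d < (di d').+1, dj d < (dj d').+1 & di d' + dj d' < (di d + dj d).+1]%N.
    by rewrite -!(ltr_nat R);
      move: h1 h2 h3 k1 k2 k3; rewrite -!natr1 !natrD => h1 h2 h3 k1 k2 k3; split; lra.
  by case=> *; apply: dij_inj; lia.
Qed.

Definition center t : plane R :=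
  match t with
  | inl u => mkp ((ui u)%:R + 1 / 3) ((uj u)%:R + 1 / 3)
  | inr d => mkp ((di d)%:R + 2 / 3) ((dj d)%:R + 2 / 3)
  end.

Lemma center_open t : open_cell t (center t).
Proof.
case: t => [u|d]; rewrite /open_cell /= ca_mkp cb_mkp.
  by rewrite -(natr1 (ui u + uj u)) natrD; split; lra.
rewrite -(natr1 (di d)) -(natr1 (dj d)) -(natr1 (di d + dj d)) natrD; split; lra.
Qed.

Lemma center_cell t : cell t (center t).
Proof. by apply: open_cellW; apply: center_open. Qed.

Lemma open_cell_center t x (e : R) : cell t x -> 0 < e <= 1 ->
  open_cell t (x + e *: (center t - x)).
Proof.
move=> tx /andP[e0 e1]; have := center_open t.
(* Applied to each of the three edge inequalities: weak at [x], strict at the center, hence strict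
   in between. *)
have h (p q : R) : p <= 0 -> q < 0 -> p + e * (q - p) < 0.
  move=> p0 q0; have : 0 <= (1 - e) * (- p) by apply: mulr_ge0; lra.
  have : 0 < e * (- q) by apply: mulr_gt0; lra.
  lra.
case: t tx => [u /up_cellP|d /down_cellP] [h1 h2 h3] [k1 k2 k3].
  split; rewrite ?caD ?caZ ?caB ?cbD ?cbZ ?cbB.
  - by have := h ((ui u)%:R - ca x) ((ui u)%:R - ca (center (inl u))); lra.
  - by have := h ((uj u)%:R - cb x) ((uj u)%:R - cb (center (inl u))); lra.
  - have := h (ca x + cb x - (ui u + uj u).+1%:R)
      (ca (center (inl u)) + cb (center (inl u)) - (ui u + uj u).+1%:R); lra.
split; rewrite ?caD ?caZ ?caB ?cbD ?cbZ ?cbB.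
- by have := h (ca x - (di d).+1%:R) (ca (center (inr d)) - (di d).+1%:R); lra.
- by have := h (cb x - (dj d).+1%:R) (cb (center (inr d)) - (dj d).+1%:R); lra.
- have := h ((di d + dj d).+1%:R - (ca x + cb x))
    ((di d + dj d).+1%:R - (ca (center (inr d)) + cb (center (inr d)))); lra.
Qed.

Lemma bigT_cells x : (0 < n)%N -> bigT R n x <-> exists t, cell t x.
Proof.
move=> n0; rewrite /bigT utriangleP // !add0n; split; last first.
  case=> -[u /up_cellP|d /down_cellP] [h1 h2 h3].
    have := uij_lt u; rewrite -(ler_nat R) => lt.
    have := ler0n R (ui u); have := ler0n R (uj u); split; lra.
  have := dij_lt d; rewrite addn1 -(ler_nat R) -!natr1 natrD => lt.
  move: h1 h2 h3; rewrite -!natr1 natrD => h1 h2 h3.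
  have := ler0n R (di d); have := ler0n R (dj d); split; lra.
case=> a0 b0 abn.
have [i /andP[i1 i2]] : exists i : nat, i%:R <= ca x < i.+1%:R.
  by exists (Num.truncn (ca x)); apply: truncn_itv.
have [j /andP[j1 j2]] : exists j : nat, j%:R <= cb x < j.+1%:R.
  by exists (Num.truncn (cb x)); apply: truncn_itv.
have up i' j' : (i' + j' < n)%N -> i'%:R <= ca x -> j'%:R <= cb x ->
    ca x + cb x <= (i' + j').+1%:R -> exists t, cell t x.
  by move=> /up_at[u <- <-] *; exists (inl u); apply/up_cellP.
have [lt|ge] := ltnP (i + j) n.
  have [le|gt] := leP (ca x + cb x) (i + j).+1%:R; first exact: (up i j).
  have [|d hi hj] := @down_at n i j.
    by rewrite addn1 -(ltr_nat R); apply: lt_le_trans gt _.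
  by exists (inr d); apply/down_cellP; rewrite hi hj; split; apply: ltW.
(* Otherwise the point is the lattice point [(i, j)] on the hypotenuse, and a neighbouring upward
   cell with smaller coordinates contains it. *)
have hij : (i + j)%:R <= n%:R :> R by rewrite natrD; lra.
rewrite ler_nat in hij; have {ge hij} ijn : (i + j)%N = n by lia.
have : n%:R = i%:R + j%:R :> R by rewrite -natrD ijn.
move=> nij; case: i => [|i] in i1 i2 ijn nij *.
  apply: (up 0%N j.-1) => //; first by lia.
    by apply: le_trans j1; rewrite ler_nat leq_pred.
  by rewrite (_ : (0 + j.-1).+1 = n) //; lia.
apply: (up i j) => //; first by lia.
  by apply: le_trans i1; rewrite ler_nat.
by rewrite (_ : (i + j).+1 = n) //; lia.
Qed.

End Cells.

(** * Topology of cells and of their unions *)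

Section Topology.
Variables (R : realType).
Implicit Types (x y v : plane R).

Lemma ca_continuous : continuous (@ca R).
Proof.
move=> x; rewrite /ca; apply: (@cvgB _ R^o); first exact: cvg_fst.
by apply: cvgMr_tmp; exact: cvg_snd.
Qed.

Lemma cb_continuous : continuous (@cb R).
Proof. by move=> x; rewrite /cb; apply: cvgMr_tmp; exact: cvg_snd. Qed.

Lemma nbhs_ray (O : set (plane R)) x v : nbhs x O ->
  exists2 e : R, 0 < e & forall t, 0 < t < e -> O (x + t *: v).
Proof.
move=> xO.
have : (fun t : R^o => x + t *: v) @ (0 : R^o) --> x + (0 : R^o) *: v.
  by apply: cvgD; [apply: cvg_cst|apply: cvgZr_tmp; apply: cvg_id].
rewrite scale0r addr0 => /(_ _ xO) /nbhs_ballP[e /= e0 he].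
exists e => // t /andP[t0 te]; apply: he.
by rewrite /ball /= sub0r normrN gtr0_norm.
Qed.

Lemma cab_continuous : continuous (fun x => ca x + cb x).
Proof. by move=> x; apply: (@cvgD _ R^o); [exact: ca_continuous|exact: cb_continuous]. Qed.

Section Cells.
Variable n : nat.
Implicit Types (t : unit_triangle n) (c : {set unit_triangle n}).

Lemma closed_cell t : closed (cell t : set (plane R)).
Proof.
have le (f : plane R -> R) r : continuous f -> closed [set x | f x <= r].
  by move=> /continuous_closedP fc; exact: (fc _ (@closed_le _ r)).
have ge (f : plane R -> R) r : continuous f -> closed [set x | r <= f x].
  by move=> /continuous_closedP fc; exact: (fc _ (@closed_ge _ r)).
have [a b ab] := And3 ca_continuous cb_continuous cab_continuous.
case: t => [u|d].
  rewrite (_ : cell _ = [set x | (ui u)%:R <= ca x] `&` [set x | (uj u)%:R <= cb x] `&`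
    [set x | ca x + cb x <= (ui u + uj u).+1%:R]); first by do !apply: closedI; auto.
  by apply/seteqP; split=> [x /up_cellP[]|x [[h1 h2] h3]] //; apply/up_cellP.
rewrite (_ : cell _ = [set x | ca x <= (di d).+1%:R] `&` [set x | cb x <= (dj d).+1%:R] `&`
  [set x | (di d + dj d).+1%:R <= ca x + cb x]); first by do !apply: closedI; auto.
by apply/seteqP; split=> [x /down_cellP[]|x [[h1 h2] h3]] //; apply/down_cellP.
Qed.

Lemma open_open_cell t : open (open_cell t : set (plane R)).
Proof.
have lt (f : plane R -> R) r : continuous f -> open [set x | f x < r].
  by move=> /continuousP fc; exact: (fc _ (@open_lt _ r)).
have gt (f : plane R -> R) r : continuous f -> open [set x | r < f x].
  by move=> /continuousP fc; exact: (fc _ (@open_gt _ r)).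
have [a b ab] := And3 ca_continuous cb_continuous cab_continuous.
case: t => [u|d].
  rewrite (_ : open_cell _ = [set x | (ui u)%:R < ca x] `&` [set x | (uj u)%:R < cb x] `&`
    [set x | ca x + cb x < (ui u + uj u).+1%:R]); first by do !apply: openI; auto.
  by apply/seteqP; split=> [x []|x [[h1 h2] h3]].
rewrite (_ : open_cell _ = [set x | ca x < (di d).+1%:R] `&` [set x | cb x < (dj d).+1%:R] `&`
  [set x | (di d + dj d).+1%:R < ca x + cb x]); first by do !apply: openI; auto.
by apply/seteqP; split=> [x []|x [[h1 h2] h3]].
Qed.

Lemma not_natr_right (r : R) :
  exists2 e : R, 0 < e & forall (t : R) (m : nat), 0 < t < e -> r + t != m%:R.
Proof.
have h1 : r < (Num.floor r + 1)%:~R by apply: floorD1_gt.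
have h0 : (Num.floor r)%:~R <= r by apply: floor_le.
exists ((Num.floor r + 1)%:~R - r); first by rewrite subr_gt0.
move=> t m /andP[t0 te]; apply/eqP => e.
have : (Num.floor r)%:~R < m%:~R :> R by rewrite -pmulrn -e; lra.
have : m%:~R < (Num.floor r + 1)%:~R :> R by rewrite -pmulrn -e; lra.
by rewrite !ltr_int; lia.
Qed.

(** In direction [mkp 1 1] the quantities [ca], [cb] and [ca + cb] all increase, so a short move
    leaves every lattice line. *)
Lemma generic_point (O : set (plane R)) x : nbhs x O ->
  exists2 y, O y & forall t, cell t y -> open_cell t y.
Proof.
move=> xO; have [e e0 he] := nbhs_ray (mkp 1 1) xO.
have [ea ea0 ha] := not_natr_right (ca x).
have [eb eb0 hb] := not_natr_right (cb x).
have [es es0 hs] := not_natr_right (ca x + cb x).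
have [r [r0 re ra rb rs]] :
    exists r : R, [/\ 0 < r, r < e, r < ea, r < eb & r + r < es].
  (* A third of the minimum, because the coordinate sum moves by [r + r]. *)
  exists (Num.min e (Num.min ea (Num.min eb es)) / 3).
  set m := Num.min _ _; have m0 : 0 < m by rewrite !lt_min e0 ea0 eb0 es0.
  have : m <= m by []; rewrite {1}/m !ge_min.
  have : [/\ m <= e, m <= ea, m <= eb & m <= es] by split; rewrite /m !ge_min lexx ?orbT.
  by case=> *; split; lra.
have lea (p : nat) : ca x + r != p%:R by apply: ha; rewrite r0.
have leb (p : nat) : cb x + r != p%:R by apply: hb; rewrite r0.
have les (p : nat) : ca x + r + (cb x + r) != p%:R.
  by rewrite addrACA; apply: hs; rewrite rs andbT; lra.
exists (x + r *: mkp 1 1); first by apply: he; rewrite r0.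
have cy : ca (x + r *: mkp 1 1) = ca x + r by rewrite caD caZ ca_mkp mulr1.
have cy' : cb (x + r *: mkp 1 1) = cb x + r by rewrite cbD cbZ cb_mkp mulr1.
case=> [u|d]; [move/up_cellP|move/down_cellP]; rewrite /open_cell /= cy cy'.
  by move=> [h1 h2 h3]; split; rewrite lt_neqAle ?h1 ?h2 ?h3 ?les // eq_sym ?lea ?leb.
by move=> [h1 h2 h3]; split; rewrite lt_neqAle ?h1 ?h2 ?h3 ?lea ?leb // eq_sym ?les.
Qed.

Definition region c : set (plane R) := \bigcup_(t in [set` c]) cell t.

Lemma closed_region c : closed (region c).
Proof. by apply: closed_bigcup => // t _; apply: closed_cell. Qed.

Lemma open_cell_region t c x : open_cell t x -> region c x -> t \in c.
Proof. by move=> tx [t' /= t'c t'x]; rewrite (open_cell_inj tx t'x). Qed.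

(** A common interior point would have a generic point of both regions nearby, and its unique cell
    would belong to both [c] and [c']. *)
Lemma region_interior_disjoint c c' : [disjoint c & c']%B ->
  interior (region c) `&` interior (region c') = set0.
Proof.
move=> dis; apply/seteqP; split=> // x [xc xc'].
have [y [[t tc ty] yc'] yg] : exists2 y, (region c `&` region c') y &
    forall t, cell t y -> open_cell t y.
  by apply: (@generic_point _ x); apply: filterI.
have := disjointFr dis tc; rewrite /= (open_cell_region (yg _ ty) yc') //.
Qed.

Lemma center_interior t (A : set (plane R)) : cell t `<=` A -> interior A (center R t).
Proof.
move=> tA; have : nbhs (center R t) (open_cell t).
  by apply: open_nbhs_nbhs; split; [exact: open_open_cell|exact: center_open].
by apply: filterS => y /open_cellW/tA.
Qed.

(** Removing [A_ R s] also removes edges of the remaining cells; the closure restores them, since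
    each point of a cell is a limit of points on its segment to the center. *)
Lemma closure_complement (s : {set up_triangle n}) : (0 < n)%N ->
  closure (bigT R n `\` A_ R s) = region (~: (inl @: s)).
Proof.
move=> n0; apply/seteqP; split.
  rewrite [X in _ `<=` X](iffLR (closure_id _) (@closed_region _)).
  apply: closureS => x [/(bigT_cells _ n0)[t tx] xs]; exists t => //=.
  rewrite finset.in_setC; apply/negP => /imsetP[u us tu]; apply: xs.
  by exists u => //; rewrite /up_cell -tu.
move=> x [t /= ts tx] O xO.
have [e e0 he] := nbhs_ray (center R t - x) xO.
have [r [r0 re r1]] : exists r : R, [/\ 0 < r, r < e & r <= 1].
  exists (Num.min e 1 / 2).
  have : Num.min e 1 <= e by rewrite ge_min lexx.
  have : Num.min e 1 <= 1 by rewrite ge_min lexx orbT.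
  have : 0 < Num.min e 1 by rewrite lt_min e0 ltr01.
  by move=> *; split; lra.
have oy : open_cell t (x + r *: (center R t - x)).
  by apply: open_cell_center => //; rewrite r0.
exists (x + r *: (center R t - x)); split; last by apply: he; rewrite r0.
split; first by apply/bigT_cells => //; exists t; apply: open_cellW.
case=> u us /(open_cell_inj oy) tu; move: ts; rewrite tu finset.in_setC => /negP; apply.
exact: imset_f.
Qed.

End Cells.
End Topology.

(** * Tiles and tilings *)

Section Tiles.
Variables (R : realType) (n : nat).
Implicit Types (x y : plane R) (u v : up_triangle n) (d : down_triangle n).

Lemma vertices_up u p : (p \in vertices (inl u)) =
  [&& ui u <= p.1, uj u <= p.2 & p.1 + p.2 <= (ui u + uj u).+1]%N.
Proof.
by case: p => p q; rewrite /= -/(ui u) -/(uj u) !inE !xpair_eqE; lia.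
Qed.

Lemma vertices_down d p : (p \in vertices (inr d)) =
  [&& p.1 <= (di d).+1, p.2 <= (dj d).+1 & (di d + dj d).+1 <= p.1 + p.2]%N.
Proof.
by case: p => p q; rewrite /= -/(di d) -/(dj d) !inE !xpair_eqE; lia.
Qed.

(** Distinct triangles of the same orientation have at most one common vertex, so an edge is shared
    only by opposite orientations. *)
Lemma share_edge_adj (t t' : unit_triangle n) : share_edge t t' ->
  exists d u, adj d u /\ (t = inl u /\ t' = inr d \/ t = inr d /\ t' = inl u).
Proof.
have adjP d u p q : p != q ->
    p \in vertices (inl u) -> q \in vertices (inl u) ->
    p \in vertices (inr d) -> q \in vertices (inr d) -> adj d u.
  case: p q => [p1 p2] [q1 q2]; rewrite !vertices_up !vertices_down /adj xpair_eqE /=.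
  by move=> /nandP[] *; lia.
case=> ne [p [q [pq pt qt pt' qt']]].
case: t t' ne pt qt pt' qt' => [u|d] [u'|d'] ne pt qt pt' qt'.
- case/eqP: ne; congr inl; move: pq pt qt pt' qt'.
  case: p q => [p1 p2] [q1 q2]; rewrite !vertices_up xpair_eqE /=.
  by move=> /nandP[] *; apply: uij_inj; lia.
- by exists d', u; split; [exact: (adjP _ _ p q)|left].
- by exists d, u'; split; [exact: (adjP _ _ p q)|right].
- case/eqP: ne; congr inr; move: pq pt qt pt' qt'.
  case: p q => [p1 p2] [q1 q2]; rewrite !vertices_down xpair_eqE /=.
  by move=> /nandP[] *; apply: dij_inj; lia.
Qed.

Lemma adj_share_edge d u : adj d u -> share_edge (inr d) (inl u).
Proof.
move=> du; split=> //.
have [p [q H]] : exists p q : nat * nat, [&& p != q,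
    p \in vertices (inr d), q \in vertices (inr d), p \in vertices (inl u)
    & q \in vertices (inl u)].
  case/or3P: du => /andP[/eqP hi /eqP hj].
  - by exists ((di d).+1, dj d), (di d, (dj d).+1);
      rewrite !vertices_up !vertices_down xpair_eqE /=; lia.
  - by exists ((di d).+1, dj d), ((di d).+1, (dj d).+1);
      rewrite !vertices_up !vertices_down xpair_eqE /=; lia.
  - by exists (di d, (dj d).+1), ((di d).+1, (dj d).+1);
      rewrite !vertices_up !vertices_down xpair_eqE /=; lia.
by exists p, q; case/and5P: H.
Qed.

(** The second base has half the length of the first. Non-collinearity transfers because the change
    of basis multiplies the determinant by [Num.sqrt 3 / 2]. *)
Lemma trapezoid_mkp (a1 a2 b1 b2 d1 d2 : R) (P : set (plane R)) :
  (b1 - a1) * (d2 - a2) != (b2 - a2) * (d1 - a1) ->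
  P = hull [:: mkp a1 a2; mkp b1 b2; mkp d1 d2 + 2^-1 *: (mkp b1 b2 - mkp a1 a2); mkp d1 d2] ->
  trapezoid P.
Proof.
move=> ne ->; exists (mkp a1 a2), (mkp b1 b2), (mkp d1 d2), 2^-1; split=> //.
apply: contra_neq ne; rewrite /mkp /= => e.
have s0 : Num.sqrt 3 / 2 != 0 :> R by rewrite mulf_neq0 ?sqrt3_neq0 // invr_eq0 pnatr_eq0.
apply: (mulfI s0); apply/eqP; rewrite -subr_eq0; move/eqP: e; rewrite -subr_eq0 => /eqP e.
by apply/eqP; rewrite -[RHS]e; ring.
Qed.

Lemma trapezoid_cells d u u' : u != u' -> adj d u -> adj d u' ->
  trapezoid (up_cell u `|` up_cell u' `|` down_cell d : set (plane R)).
Proof.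
pose I : R := (di d)%:R; pose J : R := (dj d)%:R.
pose U a b x := [/\ I + a <= ca x, J + b <= cb x & ca x + cb x <= I + J + a + b + 1].
have upE v a b : ui v = (di d + a)%N -> uj v = (dj d + b)%N ->
    up_cell v = U a%:R b%:R.
  move=> vi vj; apply/seteqP; rewrite /up_cell; split=> x; rewrite up_cellP vi vj /U;
    rewrite -(natr1 (_ + _)) !natrD -/I -/J => -[h1 h2 h3]; split; lra.
have dE : down_cell d = fun x => [/\ ca x <= I + 1, cb x <= J + 1 & I + J + 1 <= ca x + cb x].
  apply/seteqP; rewrite /down_cell; split=> x; rewrite down_cellP;
    by rewrite -(natr1 (di d + dj d)) -(natr1 (di d)) -(natr1 (dj d)) natrD.
have AB v v' : ui v = (di d + 0)%N -> uj v = (dj d + 0)%N ->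
    ui v' = (di d + 1)%N -> uj v' = (dj d + 0)%N ->
    trapezoid (up_cell v `|` up_cell v' `|` down_cell d : set (plane R)).
  move=> vi vj vi' vj'; rewrite (upE _ _ _ vi vj) (upE _ _ _ vi' vj') dE /U.
  apply: (@trapezoid_mkp I J (I + 2) J I (J + 1)); first by apply/eqP; lra.
  apply/seteqP; split=> x.
    move=> H; apply/hull4P; rewrite caD cbD caZ cbZ caB cbB !ca_mkp !cb_mkp.
    have {}H : [/\ I <= ca x, J <= cb x, cb x <= J + 1 & ca x + cb x <= I + J + 2].
      by case: H => [[[]|[]]|[]]; split; lra.
    (* The diagonal from the first to the third vertex cuts the trapezoid in two; the weights are
       those in the half containing [x]. *)
    case: H => h1 h2 h3 h4; have [h|h] := leP (ca x - I) (cb x - J).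
      by exists 0, (ca x - I), (cb x - J - (ca x - I)); split; split; lra.
    by exists ((ca x - I - (cb x - J)) / 2), (cb x - J), 0; split; split; lra.
  move/hull4P; rewrite caD cbD caZ cbZ caB cbB !ca_mkp !cb_mkp.
  move=> [r [s [t [[r0 s0 t0 rst] [hx hy]]]]].
  have [h|h] := leP (ca x + cb x) (I + J + 1); first by left; left; split; lra.
  by have [h'|h'] := leP (ca x) (I + 1); [right|left; right]; split; lra.
have AC v v' : ui v = (di d + 0)%N -> uj v = (dj d + 0)%N ->
    ui v' = (di d + 0)%N -> uj v' = (dj d + 1)%N ->
    trapezoid (up_cell v `|` up_cell v' `|` down_cell d : set (plane R)).
  move=> vi vj vi' vj'; rewrite (upE _ _ _ vi vj) (upE _ _ _ vi' vj') dE /U.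
  apply: (@trapezoid_mkp I J I (J + 2) (I + 1) J); first by apply/eqP; lra.
  apply/seteqP; split=> x.
    move=> H; apply/hull4P; rewrite caD cbD caZ cbZ caB cbB !ca_mkp !cb_mkp.
    have {}H : [/\ I <= ca x, J <= cb x, ca x <= I + 1 & ca x + cb x <= I + J + 2].
      by case: H => [[[]|[]]|[]]; split; lra.
    case: H => h1 h2 h3 h4; have [h|h] := leP (cb x - J) (ca x - I).
      by exists 0, (cb x - J), (ca x - I - (cb x - J)); split; split; lra.
    by exists ((cb x - J - (ca x - I)) / 2), (ca x - I), 0; split; split; lra.
  move/hull4P; rewrite caD cbD caZ cbZ caB cbB !ca_mkp !cb_mkp.
  move=> [r [s [t [[r0 s0 t0 rst] [hx hy]]]]].
  have [h|h] := leP (ca x + cb x) (I + J + 1); first by left; left; split; lra.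
  by have [h'|h'] := leP (cb x) (J + 1); [right|left; right]; split; lra.
have BC v v' : ui v = (di d + 1)%N -> uj v = (dj d + 0)%N ->
    ui v' = (di d + 0)%N -> uj v' = (dj d + 1)%N ->
    trapezoid (up_cell v `|` up_cell v' `|` down_cell d : set (plane R)).
  move=> vi vj vi' vj'; rewrite (upE _ _ _ vi vj) (upE _ _ _ vi' vj') dE /U.
  apply: (@trapezoid_mkp (I + 2) J I (J + 2) (I + 1) J); first by apply/eqP; lra.
  apply/seteqP; split=> x.
    move=> H; apply/hull4P; rewrite caD cbD caZ cbZ caB cbB !ca_mkp !cb_mkp.
    have {}H : [/\ I <= ca x, J <= cb x, I + J + 1 <= ca x + cb x & ca x + cb x <= I + J + 2].
      by case: H => [[[]|[]]|[]]; split; lra.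
    case: H => h1 h2 h3 h4; have [h|h] := leP (cb x - J) (I + J + 2 - ca x - cb x).
      by exists 0, (cb x - J), (I + J + 2 - ca x - cb x - (cb x - J)); split; split; lra.
    by exists ((cb x - J - (I + J + 2 - ca x - cb x)) / 2), (I + J + 2 - ca x - cb x), 0;
      split; split; lra.
  move/hull4P; rewrite caD cbD caZ cbZ caB cbB !ca_mkp !cb_mkp.
  move=> [r [s [t [[r0 s0 t0 rst] [hx hy]]]]].
  have [h|h] := leP (I + 1) (ca x); first by left; left; split; lra.
  by have [h'|h'] := leP (cb x) (J + 1); [right|left; right]; split; lra.
rewrite /adj => uu' /or3P[] /andP[/eqP hi /eqP hj] /or3P[] /andP[/eqP hi' /eqP hj'];
  try by case/eqP: uu'; apply: uij_inj; lia.
- by apply: AB; lia.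
- by apply: AC; lia.
- by rewrite [X in trapezoid (X `|` _)]setUC; apply: AB; lia.
- by apply: BC; lia.
- by rewrite [X in trapezoid (X `|` _)]setUC; apply: AC; lia.
- by rewrite [X in trapezoid (X `|` _)]setUC; apply: BC; lia.
Qed.

End Tiles.

(** * Passage between tilings and independent sets *)

Section Tilings.
Variables (R : realType) (n : nat).
Implicit Types (x y : plane R) (u v : up_triangle n) (d e : down_triangle n).
Implicit Types (s : {set up_triangle n}).

(** Each triple of bounds admits a single pair of coordinates; this is the form in which
    inequalities between reals yield adjacency. *)
Lemma adj_bounds d u :
  [\/ [/\ ui u < (di d).+1, uj u < (dj d).+1 & di d + dj d < (ui u + uj u).+1],
      [/\ ui u < (di d).+2, uj u < (dj d).+1 & di d + dj d < ui u + uj u]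
    | [/\ ui u < (di d).+1, uj u < (dj d).+2 & di d + dj d < ui u + uj u]]%N ->
  adj d u.
Proof.
by case=> -[h1 h2 h3]; apply/or3P; [constructor 1|constructor 2|constructor 3];
  apply/andP; split; apply/eqP; lia.
Qed.

(* Convexity: a segment from the midpoint [m] of an edge of [d] to a point beyond
   that edge stays in the trapezoid, and near [m] it can only run in the upward
   triangle across the edge. *)
Lemma trapezoid_adj d u u' :
  trapezoid (up_cell u `|` up_cell u' `|` down_cell d : set (plane R)) ->
  exists2 v, v = u \/ v = u' & adj d v.
Proof.
set P := (X in trapezoid X) => -[a [b [c [r [_ _ eP]]]]].
have conv x y t : 0 <= t <= 1 -> P x -> P y -> P (x + t *: (y - x)).
  by rewrite eP; apply: hull_convex.
pose I : R := (di d)%:R; pose J : R := (dj d)%:R; pose N : R := n%:R.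
have IJ0 : 0 <= I /\ 0 <= J by rewrite !ler0n.
have IJN : I + J + 2 <= N.
  by have := dij_lt d; rewrite addn1 -(ler_nat R) -!natr1 natrD /I /J /N; lra.
(* The factor keeps each coordinate of the displacement below 1/4, so from the midpoint of an edge
   no lattice line other than that of the edge is crossed. *)
pose z m := m + (4 * N + 4)^-1 *: (center R (inl u) - m).
have N1 : (4 * N + 4)^-1 * (4 * N + 4) = 1 by rewrite mulVf //; apply/eqP; lra.
have N0 : 0 < (4 * N + 4)^-1 by rewrite invr_gt0; lra.
set k := (4 * N + 4)^-1 in z N1 N0.
have kP (q : R) : - N <= q <= N -> - (1 / 4) < k * q < 1 / 4.
  move=> /andP[q1 q2]; have : 0 < k * (N + 1 - q) by apply: mulr_gt0; lra.
  have : 0 < k * (N + 1 + q) by apply: mulr_gt0; lra.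
  by move=> *; apply/andP; split; lra.
have cu : P (center R (inl u)) by left; left; apply: center_cell.
have zP m : down_cell d m -> P (z m).
  move=> dm; apply: conv => //; last by right.
  have : 0 <= k * (4 * N + 3) by apply: mulr_ge0; lra.
  by move=> ?; apply/andP; split; lra.
have out m : down_cell d m -> ~ down_cell d (z m) -> exists2 v, v = u \/ v = u' & up_cell v (z m).
  by move=> /zP [[h|h]|//] _; [exists u => //; left|exists u' => //; right].
have zE (p q : R) : ca (z (mkp p q)) = p + k * ((ui u)%:R + 1 / 3 - p) /\
    cb (z (mkp p q)) = q + k * ((uj u)%:R + 1 / 3 - q).
  by rewrite /z caD cbD caZ cbZ caB cbB /= !ca_mkp !cb_mkp.
have uN : [/\ 0 <= (ui u)%:R :> R, 0 <= (uj u)%:R :> R & (ui u)%:R + (uj u)%:R + 1 <= N].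
  by split; rewrite ?ler0n //; have := uij_lt u; rewrite -(ler_nat R) -natr1 natrD.
have dE x : down_cell d x <-> [/\ ca x <= I + 1, cb x <= J + 1 & I + J + 1 <= ca x + cb x].
  by rewrite /down_cell down_cellP -(natr1 (di d + dj d)) -(natr1 (di d)) -(natr1 (dj d)) natrD.
have bd (p q : R) : 0 <= p <= N - 1 -> 0 <= q <= N - 1 ->
    [/\ - (1 / 4) < k * ((ui u)%:R + 1 / 3 - p) < 1 / 4
      & - (1 / 4) < k * ((uj u)%:R + 1 / 3 - q) < 1 / 4].
  by case: uN => ? ? ? /andP[? ?] /andP[? ?]; split; apply: kP; apply/andP; split; lra.
(* The center of [u] lies strictly beyond one of the three edges of [d]; in each case the midpoint
   of that edge is taken. *)
have : (di d < ui u \/ dj d < uj u \/ ui u + uj u <= di d + dj d)%N by lia.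
case=> [h|[h|h]].
- have h' : I + 1 <= (ui u)%:R by rewrite natr1 ler_nat.
  have [za zb] := zE (I + 1) (J + 1 / 2).
  have [||/andP[a1 a2] /andP[b1 b2]] := bd (I + 1) (J + 1 / 2); try (apply/andP; split; lra).
  have pos : 0 < k * ((ui u)%:R + 1 / 3 - (I + 1)) by apply: mulr_gt0; lra.
  have [||v vu /up_cellP] := out (mkp (I + 1) (J + 1 / 2)).
  + by apply/dE; rewrite ca_mkp cb_mkp; split; lra.
  + by move/dE; rewrite za zb => -[]; lra.
  rewrite za zb -(natr1 (ui v + uj v)) natrD => -[h1 h2 h3]; exists v => //.
  clear IJ0 IJN N1 N0 uN pos h' za zb h.
  have : [/\ ui v < (di d).+2, uj v < (dj d).+1 & di d + dj d < ui v + uj v]%N.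
    by rewrite -!(ltr_nat R) -!(natr1 (di d).+1) -(natr1 (di d)) -(natr1 (dj d)) !natrD -/I -/J;
      split; lra.
  by move=> hv; apply: adj_bounds; constructor 2.
- have h' : J + 1 <= (uj u)%:R by rewrite natr1 ler_nat.
  have [za zb] := zE (I + 1 / 2) (J + 1).
  have [||/andP[a1 a2] /andP[b1 b2]] := bd (I + 1 / 2) (J + 1); try (apply/andP; split; lra).
  have pos : 0 < k * ((uj u)%:R + 1 / 3 - (J + 1)) by apply: mulr_gt0; lra.
  have [||v vu /up_cellP] := out (mkp (I + 1 / 2) (J + 1)).
  + by apply/dE; rewrite ca_mkp cb_mkp; split; lra.
  + by move/dE; rewrite za zb => -[]; lra.
  rewrite za zb -(natr1 (ui v + uj v)) natrD => -[h1 h2 h3]; exists v => //.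
  clear IJ0 IJN N1 N0 uN pos h' za zb h.
  have : [/\ ui v < (di d).+1, uj v < (dj d).+2 & di d + dj d < ui v + uj v]%N.
    by rewrite -!(ltr_nat R) -!(natr1 (dj d).+1) -(natr1 (di d)) -(natr1 (dj d)) !natrD -/I -/J;
      split; lra.
  by move=> hv; apply: adj_bounds; constructor 3.
- have h' : (ui u)%:R + (uj u)%:R <= I + J by rewrite -!natrD ler_nat.
  have [za zb] := zE (I + 1 / 2) (J + 1 / 2).
  have [||/andP[a1 a2] /andP[b1 b2]] := bd (I + 1 / 2) (J + 1 / 2); try (apply/andP; split; lra).
  have pos : 0 < k * (I + J + 1 / 3 - ((ui u)%:R + (uj u)%:R)) by apply: mulr_gt0; lra.
  have [||v vu /up_cellP] := out (mkp (I + 1 / 2) (J + 1 / 2)).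
  + by apply/dE; rewrite ca_mkp cb_mkp; split; lra.
  + by move/dE; rewrite za zb => -[]; lra.
  rewrite za zb -(natr1 (ui v + uj v)) natrD => -[h1 h2 h3]; exists v => //.
  clear IJ0 IJN N1 N0 uN pos h' za zb h.
  have : [/\ ui v < (di d).+1, uj v < (dj d).+1 & di d + dj d < (ui v + uj v).+1]%N.
    by rewrite -!(ltr_nat R) -(natr1 (di d)) -(natr1 (dj d)) -(natr1 (ui v + uj v)) !natrD -/I -/J;
      split; lra.
  by move=> hv; apply: adj_bounds; constructor 1.
Qed.

Lemma ups_in_utriangle k i j : (0 < k)%N ->
  ups_in n (utriangle R k i j) = upsT n i j k.
Proof.
move=> k0; apply/setP => u; rewrite !inE; apply/asboolP/and3P.
  move=> sub.
  (* Two vertices suffice: the lower left one gives both lower bounds, the lower right one the bound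
     on the sum. *)
  have /sub/utriangleP-/(_ k0) : up_cell u (mkp (ui u)%:R (uj u)%:R : plane R).
    by apply/up_cellP; rewrite ca_mkp cb_mkp -natr1 natrD; split; lra.
  have /sub/utriangleP-/(_ k0) : up_cell u (mkp (ui u).+1%:R (uj u)%:R : plane R).
    by apply/up_cellP; rewrite ca_mkp cb_mkp -!natr1 natrD; split; lra.
  by rewrite !ca_mkp !cb_mkp -!natrD !ler_nat => -[_ _ h] [h1 h2 _]; split=> //; lia.
move=> [h1 h2 h3] x /up_cellP[k1 k2 k3]; apply/utriangleP => //; split.
- by apply: le_trans k1; rewrite ler_nat.
- by apply: le_trans k2; rewrite ler_nat.
- by apply: le_trans k3 _; rewrite ler_nat.
Qed.

Lemma tm_independentP s : tm_independent R s <-> independent s.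
Proof.
split=> ind.
  move=> k a b k0 kn; rewrite -ups_in_utriangle //; apply: ind; first by lia.
  by exists a, b.
move=> k T /andP[k0 kn] [i [j [ijn ->]]].
by rewrite ups_in_utriangle //; apply: ind => //; lia.
Qed.

(** Treats both kinds of tile alike: one downward triangle, recognised by its center, and an upward
    neighbour of it to serve as its match. *)
Lemma tile_adj (P : set (plane R)) : unit_rhombus n P \/ type1_trapezoid n P ->
  exists d u, [/\ adj d u, up_cell u `<=` P, down_cell d `<=` P &
    forall e, P (center R (inr e)) -> e = d].
Proof.
case=> [[t [t' [/share_edge_adj[d [u [du tE]]] ->]]]|[tr [u [u' [d [_ PE]]]]]].
  exists d, u; split=> //.
  - by case: tE => [[-> ->]|[-> ->]] x ?; [left|right].
  - by case: tE => [[-> ->]|[-> ->]] x ?; [right|left].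
  - by move=> e; case: tE => [[-> ->]|[-> ->]] [] /(open_cell_inj (center_open _ _)) // [].
rewrite {}PE in tr *; have [v vu dv] := trapezoid_adj tr.
exists d, v; split; first exact: dv.
- by case: vu => [->|->] x vx; [left; left|left; right].
- by move=> x dx; right.
by move=> e [[]|] /(open_cell_inj (center_open _ _)) // [].
Qed.

Lemma tiling_independent s (C : set (set (plane R))) : (0 < n)%N ->
  tiling n (bigT R n `\` A_ R s) C ->
  (forall P, C P -> unit_rhombus n P \/ type1_trapezoid n P) -> independent s.
Proof.
move=> n0; rewrite /tiling closure_complement // => -[_ dis cov] tile.
have /choice[g gP] : forall d, exists uQ : up_triangle n * set (plane R),
    [/\ adj d uQ.1 && (uQ.1 \notin s), C uQ.2, up_cell uQ.1 `<=` uQ.2,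
      uQ.2 (center R (inr d)) & forall e, uQ.2 (center R (inr e)) -> e = d].
  move=> d; have : @region R _ (~: (inl @: s))%SET (center R (inr d)).
    exists (inr d); last exact: center_cell.
    by rewrite /= finset.in_setC; apply/imsetP => -[].
  rewrite -cov => -[Q CQ Qd]; have [e [u [eu uQ eQ uniq]]] := tile_adj (tile _ CQ).
  have ed := uniq _ Qd; rewrite -{}ed in eu eQ uniq; exists (u, Q); split=> //=.
  rewrite eu /=; have : @region R _ (~: (inl @: s))%SET (center R (inl u)).
    by rewrite -cov; exists Q => //; apply: uQ; apply: center_cell.
  move/(open_cell_region (center_open _ _)); rewrite finset.in_setC.
  by apply: contra => us; apply: imset_f.
apply: (@matching_independent _ _ (fun d => (g d).1)); last first.
  by move=> d; have [] := gP d.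
move=> d e gde; have [_ Cd uQd _ du] := gP d; have [_ Ce uQe eQ _] := gP e.
(* A shared upward triangle would have its center in the interiors of two distinct tiles. *)
have QQ : (g d).2 = (g e).2.
  apply: contrapT => ne.
  suff : (set0 : set (plane R)) (center R (inl (g d).1)) by [].
  rewrite -(dis _ _ Cd Ce ne); split; apply: center_interior => //.
  by move: gde => /= ->.
by apply/esym/du; rewrite QQ.
Qed.

Definition tile_of (F : down_triangle n -> {set up_triangle n}) d : {set unit_triangle n} :=
  (inr d |: inl @: F d)%SET.

Lemma independent_tiling s : (0 < n)%N -> ~ ((n <= 2)%N /\ #|s| = 0%N) -> independent s ->
  exists C : set (set (plane R)),
    [/\ tiling n (bigT R n `\` A_ R s) C,
        forall P, C P -> unit_rhombus n P \/ type1_trapezoid n P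
      & exists m : nat, (m + #|s|)%N = n /\
          C `&` [set P | type1_trapezoid n P] #= `I_m].
Proof.
move=> n0 hex ind; have [F [Fadj Fcov Fdis F12 Fcard]] := independent_assignment n0 hex ind.
pose Q d : set (plane R) := @region R _ (tile_of F d).
have in_tile d t : t \in tile_of F d -> t = inr d \/ exists2 u, u \in F d & t = inl u.
  by rewrite finset.in_setU1 => /orP[/eqP|/imsetP[u uF ->]]; [left|right; exists u].
have tile_dis d e : d <> e -> [disjoint tile_of F d & tile_of F e]%B.
  move=> de; rewrite -setI_eq0; apply/eqP/setP => t; rewrite finset.in_setI finset.in_set0.
  apply/negP => /andP[/in_tile td /in_tile te].
  case: td te => [->|[u uF ->]] [[]|[v vF []]] //.
  by move=> vu; apply: de; rewrite (Fdis d e u) // vu.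
have Qcells d x : Q d x <-> (down_cell d x \/ exists2 u, u \in F d & up_cell u x).
  split=> [[t /= /in_tile[->|[u uF ->]] tx]|[dx|[u uF ux]]].
  - by left.
  - by right; exists u.
  - by exists (inr d) => //=; rewrite finset.in_setU1 eqxx.
  - by exists (inl u) => //=; rewrite finset.in_setU1 imset_f ?orbT.
have Qdown d e : Q d (center R (inr e)) -> e = d.
  by move/(open_cell_region (center_open _ _))/in_tile => [[]|[]].
have Qup d u : Q d (center R (inl u)) -> u \in F d.
  by move/(open_cell_region (center_open _ _))/in_tile => [|[v vF [->]]].
have Qc d : Q d (center R (inr d)) by apply/Qcells; left; apply: center_cell.
have Qinj : injective Q by move=> d e de; apply: Qdown; rewrite -de.
have Qtile d : if #|F d| == 2%N then type1_trapezoid n (Q d) else unit_rhombus n (Q d).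
  case: ifP => [/eqP/eqP/cards2P[u [u' [uu' FE]]]|F2].
    have QE : Q d = up_cell u `|` up_cell u' `|` down_cell d.
      apply/seteqP; split=> x; rewrite Qcells.
        by case=> [|[v]]; [right|rewrite FE !inE => /orP[] /eqP ->; left; [left|right]].
      by case=> [[]|] ?; [right; exists u|right; exists u'|left]; rewrite // FE !inE eqxx ?orbT.
    split; last by exists u, u', d; split.
    have [du _] : adj d u /\ u \notin s by apply: Fadj; rewrite FE !inE eqxx.
    have [du' _] : adj d u' /\ u' \notin s by apply: Fadj; rewrite FE !inE eqxx orbT.
    by rewrite QE; apply: trapezoid_cells.
  have /cards1P[u FE] : #|F d| == 1%N by move: (F12 d) F2; lia.
  have [du _] : adj d u /\ u \notin s by apply: Fadj; rewrite FE inE.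
  exists (inr d), (inl u); split; first exact: adj_share_edge.
  apply/seteqP; split=> x; rewrite Qcells.
    by case=> [|[v]]; [left|rewrite FE inE => /eqP ->; right].
  by case=> ?; [left|right; exists u; rewrite // FE inE].
exists (range Q); split.
- rewrite /tiling closure_complement //; split.
  + move=> _ [d _ <-]; split; first exact: closed_region.
    split; first by exists (center R (inr d)).
      by move=> x [t _ tx]; apply/bigT_cells => //; exists t.
    by exists (tile_of F d); rewrite -(iffLR (closure_id _) (@closed_region _ _ _)).
  + move=> _ _ [d _ <-] [e _ <-] de; apply: region_interior_disjoint.
    by apply: tile_dis => E; apply: de; rewrite E.
  + apply/seteqP; split=> x.
      move=> [_ [d _ <-] [t /= /in_tile td tx]]; exists t => //=.
      rewrite finset.in_setC; apply/imsetP => -[v vs tv].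
      case: td => [|[u uF]]; rewrite tv // => -[vu].
      by have [_] := Fadj _ _ uF; rewrite -vu vs.
    case=> -[u|d] /=; rewrite finset.in_setC => ts tx; last first.
      by exists (Q d); [exists d|apply/Qcells; left].
    have [|d ud] := Fcov u; first by apply: contra ts; apply: imset_f.
    by exists (Q d); [exists d|apply/Qcells; right; exists u].
- by move=> _ [d _ <-]; have := Qtile d; case: ifP; [right|left].
- exists #|[set d | #|F d| == 2%N]%SET|; split=> //.
  set D2 := [set d | _]%SET; rewrite (card_eqr card_II).
  have -> : range Q `&` [set P | type1_trapezoid n P] =
      (* A tile [Q d] that is a type-1 trapezoid contains the centers of two distinct upward
         triangles, both thus in [F d]; with [Qinj], counting these tiles amounts to counting
         [D2]. *)
      (fun i : 'I_#|D2| => Q (enum_val i)) @` [set: 'I_#|D2|].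
    apply/seteqP; split=> [_ [[d _ <-] /= [_ [u [u' [e [uu' QE]]]]]]|_ [i _ <-]].
      have dD : d \in D2.
        have uF : u \in F d by apply: Qup; rewrite QE; left; left; apply: center_cell.
        have uF' : u' \in F d by apply: Qup; rewrite QE; left; right; apply: center_cell.
        rewrite inE eqn_leq; have /andP[_ ->] /= := F12 d.
        have /subset_leq_card : ([set u; u'] \subset F d)%SET.
          by apply/fintype.subsetP => v; rewrite !inE => /orP[] /eqP ->.
        by rewrite cards2 uu'.
      by exists (enum_rank_in dD d) => //; rewrite enum_rankK_in.
    split; first by exists (enum_val i).
    by have := Qtile (enum_val i); have := enum_valP i; rewrite inE => ->.
  by apply: inj_card_eq => i j _ _ /Qinj/enum_val_inj.
Qed.

End Tilings.

End Geometry.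

(* The equivalence fails, and is excluded by [hex], exactly when s is empty and
   n is 1 or 2: T_1 and T_2 have fewer than n downward triangles, so cannot
   contain n non-overlapping type-1 trapezoids, while the empty set is
   independent. *)
Theorem theorem3p2 (R : realType) (n : nat) (hn : (1 <= n)%N) (s : {set up_triangle n})
    (hex : ~ ((n <= 2)%N /\ #|s| = 0%N)) :
  tm_independent R s <->
  exists C : set (set (plane R)),
    [/\ tiling n (bigT R n `\` A_ R s) C,
        forall P, C P -> unit_rhombus n P \/ type1_trapezoid n P
      & exists m : nat, (m + #|s|)%N = n /\
          C `&` [set P | type1_trapezoid n P] #= `I_m].
Proof.
rewrite tm_independentP; split; first exact: independent_tiling.
by move=> [C [tC CP _]]; apply: tiling_independent tC CP.
Qed.
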